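(* Let $X$ be an $n$-dimensional nonsingular projective subvariety of $\mathbb{P}^N(K)$ and let $P_1,\dots,P_q$, $q\ge 2$, be non-constant homogeneous polynomials in $N+1$ variables over $K$. Let $D_i=X\cap\{P_i=0\}$, $1\le i\le q$, be divisors of $X$ in general position. Let $f$ be an analytic map from $K$ to $X\setminus\bigcup_{i=1}^q D_i$. Then the image of $f$ is contained in a subvariety of $X$ of codimension $\min\{n+1,q\}-1$ in $X$. In particular, $f$ is algebraically degenerate if $q\ge 2$, and $X\setminus\bigcup_{i=1}^q D_i$ is $K$-hyperbolic if $q\ge n+1$.
   Context: $K$ is an algebraically closed field of arbitrary characteristic, complete with respect to a non-archimedean absolute value $|\cdot|$. Varieties are irreducible. A $K$-analytic function on $K$ is a function given by a power series with coefficients in $K$ converging on all of $K$. An analytic map $f:K\to\mathbb{P}^N(K)$ is a map $f=[f_0:\dots:f_N]$ where $f_0,\dots,f_N$ are $K$-analytic functions on $K$ with no common zero (a reduced representation). An analytic map from $K$ to a subset $Y\subset\mathbb{P}^N(K)$ is such a map with image contained in $Y$. A variety $Y$ over $K$ is $K$-hyperbolic if every analytic map from $K$ to $Y$ is constant. An analytic map into (a subset of) $X$ is algebraically degenerate if its image is contained in a proper algebraic subset of $X$. Saying that $D_i=X\cap\{P_i=0\}$ is a divisor of $X$ means in particular that $P_i$ does not vanish identically on $X$. A collection of $q$ effective divisors $D_1,\dots,D_q$ of the $n$-dimensional projective variety $X$ is in general position if: (i) when $q\le n$, the codimension in $X$ of each component of $\bigcap_{j=1}^q D_j$ is $q$;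 (ii) when $q\ge n+1$, for any subset $\{i_0,\dots,i_n\}$ of $\{1,\dots,q\}$ of cardinality $n+1$, $\bigcap_{j=0}^n D_{i_j}=\emptyset$.
   Formalization: The claim that f is algebraically degenerate is stated only for n ≥ 1; for n = 0, X is a point whose only proper algebraic subset is empty, so that claim fails as written. *)

(* Defs.v *)
From HB Require Import structures.
From mathcomp Require Import all_boot all_order all_algebra.
From mathcomp Require Import classical_sets reals.
From mathcomp Require Import mpoly.

Set Implicit Arguments.
Unset Strict Implicit.
Unset Printing Implicit Defensive.

Import Order.TTheory GRing.Theory Num.Theory.
Local Open Scope classical_set_scope.
Local Open Scope ring_scope.

(* The trivial absolute value is allowed. *)
Record nonarch_absval (R : realType) (K : fieldType) (abs : K -> R) : Prop :=
  NonarchAbsval {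
    absval_ge0 : forall x, 0 <= abs x;
    absval_eq0 : forall x, abs x = 0 <-> x = 0;
    absvalM : forall x y, abs (x * y) = abs x * abs y;
    absvalD_max : forall x y, abs (x + y) <= Num.max (abs x) (abs y) }.

Section Analytic.
Context {R : realType} {K : fieldType} (abs : K -> R).

Definition abs_cvg (u : nat -> K) (l : K) : Prop :=
  forall e : R, 0 < e ->
    exists m : nat, forall k, (m <= k)%N -> abs (u k - l) < e.

Definition abs_cauchy (u : nat -> K) : Prop :=
  forall e : R, 0 < e ->
    exists m : nat, forall j k, (m <= j)%N -> (m <= k)%N -> abs (u j - u k) < e.

Definition abs_complete : Prop :=
  forall u : nat -> K, abs_cauchy u -> exists l, abs_cvg u l.

Definition analytic_fun (g : K -> K) : Prop :=
  exists a : nat -> K,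
    forall z, abs_cvg (fun m => \sum_(k < m) a k * z ^+ k) (g z).

End Analytic.

(* P^N(K), as the set of lines through the origin in K^(N+1). *)
Definition proj_space (K : fieldType) (N : nat) : Type :=
  {L : {vspace 'rV[K]_N.+1} | \dim L == 1%N}.

Section Projective.
Context {K : fieldType} {N : nat}.
Local Notation PN := (proj_space K N).
Local Notation poly := {mpoly K[N.+1]}.

Definition is_homog (F : poly) : Prop := exists d : nat, F \is d.-homog.

(* For homogeneous F this says that F vanishes at one, equivalently at every,
   vector of homogeneous coordinates of p. *)
Definition vanishes_at (F : poly) (p : PN) : Prop :=
  forall x : 'rV[K]_N.+1, x \in val p -> F.@[x 0] = 0.

Definition zeros (F : poly) : set PN := [set p | vanishes_at F p].

Definition algebraic_set (Y : set PN) : Prop :=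
  exists2 S : set poly, (forall F, S F -> is_homog F) &
    Y = \bigcap_(F in S) zeros F.

Definition variety (Y : set PN) : Prop :=
  [/\ algebraic_set Y, Y !=set0 &
      forall Y1 Y2, algebraic_set Y1 -> algebraic_set Y2 ->
        Y `<=` Y1 `|` Y2 -> Y `<=` Y1 \/ Y `<=` Y2].

Definition component (Y Z : set PN) : Prop :=
  [/\ variety Z, Z `<=` Y &
      forall Z', variety Z' -> Z `<=` Z' -> Z' `<=` Y -> Z' = Z].

Definition dim_ge (Y : set PN) (d : nat) : Prop :=
  exists Z : nat -> set PN,
    (forall i, (i <= d)%N -> variety (Z i) /\ Z i `<=` Y) /\
    (forall i, (i < d)%N -> Z i `<` Z i.+1).

(* dim Y = n: n is the largest length of a chain of irreducible closed subsets
   of Y. *)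
Definition has_dim (Y : set PN) (n : nat) : Prop :=
  dim_ge Y n /\ forall d, dim_ge Y d -> (d <= n)%N.

Definition has_codim (X Z : set PN) (c : nat) : Prop :=
  exists n d : nat, [/\ has_dim X n, has_dim Z d & (d + c = n)%N].

(* The homogeneous elements of the ideal I(Y), which generate it. *)
Definition vanishing_forms (Y : set PN) : set poly :=
  [set F | is_homog F /\ Y `<=` zeros F].

(* v belongs to the Zariski tangent space at x of the affine cone over Y. *)
Definition cone_tangent (Y : set PN) (x v : 'rV[K]_N.+1) : Prop :=
  forall F, vanishing_forms Y F -> \sum_i (F^`M(i)).@[x 0] * v 0 i = 0.

(* At every point p = [x] of Y, the tangent space of the affine cone at x has
   dimension n + 1, i.e. the projective tangent space at p has dimension n;
   equivalently the Jacobian of I(Y) at x has rank N - n. *)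
Definition nonsingular_of_dim (Y : set PN) (n : nat) : Prop :=
  forall (p : PN) (x : 'rV[K]_N.+1), Y p -> x \in val p -> x != 0 ->
    exists2 T : {vspace 'rV[K]_N.+1},
      (forall v, v \in T <-> cone_tangent Y x v) & \dim T = n.+1.

(* Zero loci on X suffice here: general position only involves supports. *)
Definition general_position (X : set PN) (n q : nat) (D : 'I_q -> set PN) :
    Prop :=
  ((q <= n)%N -> forall Z, component (\bigcap_j D j) Z -> has_codim X Z q) /\
  ((n.+1 <= q)%N -> forall I : {set 'I_q}, #|I| = n.+1 ->
     \bigcap_(j in [set` I]) D j = set0).

End Projective.

Section AnalyticMaps.
Context {R : realType} {K : fieldType} (abs : K -> R) {N : nat}.
Local Notation PN := (proj_space K N).

Definition analytic_map (f : K -> PN) : Prop :=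
  exists g : K -> 'rV[K]_N.+1,
    [/\ forall i, analytic_fun abs (fun z => g z 0 i),
        forall z, exists i, g z 0 i != 0 &
        forall z, val (f z) = <[g z]>%VS].

Definition analytic_map_to (Y : set PN) (f : K -> PN) : Prop :=
  analytic_map f /\ forall z, Y (f z).

Definition K_hyperbolic (Y : set PN) : Prop :=
  forall f, analytic_map_to Y f -> exists p, forall z, f z = p.

Definition algebraically_degenerate (X : set PN) (f : K -> PN) : Prop :=
  exists Z, [/\ algebraic_set Z, Z `<` X & forall z, Z (f z)].

End AnalyticMaps.

(* Main.v *)
(** A zero-free entire function over a complete algebraically closed non-archimedean field is
    constant, so along f = [g] every P_i(g) is a nonzero constant c_i.  On the Zariski closure W of
    the image, a common power of P_i is therefore a fixed nonzero multiple of one of P_j, and W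
    meets one divisor only where it meets all of them: general position forces dim W <= n - c with
    c = min(n + 1, q) - 1.  It remains to interpolate a variety of dimension exactly n - c between
    W and X, i.e. to show that, in a chain W < V, V contains a subvariety of codimension one
    through W.

    Dimension theory rests on two facts about forms on V.  A chain of length d gives d + 1
    algebraically independent forms; m forms without common zero on V make its coordinate ring
    finite over them, and counting monomials then gives d < m.  For the interpolation, take F in
    I(W) not vanishing on V and complete it to d + 1 forms without common zero: the coordinate ring
    is finite over a polynomial ring in which F is a variable.  If all components of V /\ {F = 0}
    through W were too small, a power of a form a not vanishing on W would become, after
    multiplication by a polynomial prime to F, a multiple of F; then a^k / F is integral and a
    vanishes on W. *)

Require Import Defs.
From HB Require Import structures.
From mathcomp Require Import all_boot all_order all_algebra.
From mathcomp Require Import boolp classical_sets reals.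
From mathcomp Require Import mpoly.
From mathcomp Require Import ring lra zify.

Set Implicit Arguments.
Unset Strict Implicit.
Unset Printing Implicit Defensive.

Import Order.TTheory GRing.Theory Num.Theory.
Local Open Scope classical_set_scope.
Local Open Scope ring_scope.

(** * Hilbert's basis theorem *)

(** The number c comes from one count. Cutting W by a single divisor costs at most one dimension,
    and the section lies in all q divisors at once. So dim W - 1 <= n - q when q <= n, while for q
    >= n + 1 the section is empty and dim W = 0. Interpolation takes work because dimension is
    measured by the longest chains, and such a chain in X need not pass through W; what has to be
    proved is a form of catenarity. Coordinate rings appear as polynomial functions on the affine
    cone, and an identity means equality at every point of the cone. The cones over a chain of
    length d, preceded by the origin, form a chain of length d + 1; hence the d + 1 independent
    forms. A nonconstant entire function has a zero because, at a large radius, some term of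
    positive index dominates. Every long truncation then has a root in the disc, each root can be
    chosen near the previous one, and completeness supplies the limit. *)

Lemma strict_mono_lt (phi : nat -> nat) :
  (forall i, (phi i < phi i.+1)%N) -> forall i j, (i < j)%N -> (phi i < phi j)%N.
Proof.
move=> h i; elim=> // j IH; rewrite ltnS leq_eqVlt => /orP[/eqP <- //|/IH lt].
exact: ltn_trans (h j).
Qed.

(** Each new index minimises [a] on the tail after the previous one; later indices lie in the
    earlier tails, so their values are no smaller. *)
Lemma nondecreasing_subseq (a : nat -> nat) :
  exists phi : nat -> nat, (forall i, (phi i < phi i.+1)%N) /\
    forall i j, (i <= j)%N -> (a (phi i) <= a (phi j))%N.
Proof.
have hmin k : exists j, (k <= j)%N /\ forall i, (k <= i)%N -> (a j <= a i)%N.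
  have ex : exists v, `[< exists2 j, (k <= j)%N & a j = v >].
    by exists (a k); apply/asboolP; exists k.
  case: (ex_minnP ex) => v /asboolP [j kj <-] vmin.
  by exists j; split=> // i ki; apply: vmin; apply/asboolP; exists i.
have [g hg] := choice hmin.
pose phi := fix phi i := if i is i'.+1 then g (phi i').+1 else g 0%N.
have phiS i : (phi i < phi i.+1)%N by have [] := hg (phi i).+1.
exists phi; split=> // i j; rewrite leq_eqVlt => /orP[/eqP -> //|ltij].
have := strict_mono_lt phiS ltij => /= lt.
case: i {ltij} lt => [|i] lt; first by apply: (proj2 (hg _)).
by apply: (proj2 (hg _)); apply: ltn_trans (phiS i) lt.
Qed.

(** Passing to a subsequence once per coordinate makes all exponents nondecreasing; its first two
    terms are then comparable. *)
Lemma dickson (n : nat) (m : nat -> 'X_{1..n}) :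
  exists i j, (i < j)%N /\ (m i <= m j)%MM.
Proof.
suff h k : (k <= n)%N -> exists phi : nat -> nat,
    (forall i, (phi i < phi i.+1)%N) /\
    forall (l : 'I_n) i j, (l < k)%N -> (i <= j)%N -> (m (phi i) l <= m (phi j) l)%N.
  have [phi [phiS hphi]] := h n (leqnn n).
  by exists (phi 0%N), (phi 1%N); split=> //; apply/mnm_lepP => l; apply: hphi.
elim: k => [|k IH] kn; first by exists id; split=> // l i j.
have [phi [phiS hphi]] := IH (ltnW kn).
have [psi [psiS hpsi]] := nondecreasing_subseq (fun i => m (phi i) (Ordinal kn)).
exists (phi \o psi); split=> [i /=|l i j].
  exact: strict_mono_lt.
rewrite ltnS leq_eqVlt => /orP[/eqP elk|lk] ij /=.
  by rewrite (_ : l = Ordinal kn); [apply: hpsi|apply: val_inj].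
apply: hphi => //; move: ij; rewrite leq_eqVlt => /orP[/eqP -> //|ij].
exact/ltnW/strict_mono_lt.
Qed.

Record ideal_pred (R : nzRingType) (I : R -> Prop) : Prop := IdealPred {
  ideal0 : I 0;
  idealD : forall p q, I p -> I q -> I (p + q);
  idealMl : forall p q, I q -> I (p * q) }.

Section Ideals.
Context {R : comNzRingType} {I : R -> Prop} (hI : ideal_pred I).

Lemma idealMr p q : I p -> I (p * q).
Proof. by move=> Ip; rewrite mulrC; apply: idealMl. Qed.

Lemma idealN p : I p -> I (- p).
Proof. by move=> Ip; rewrite -mulN1r; apply: idealMl. Qed.

Lemma idealB p q : I p -> I q -> I (p - q).
Proof. by move=> Ip Iq; apply: idealD => //; apply: idealN. Qed.

Lemma ideal_sum (J : Type) (r : seq J) (P : pred J) (F : J -> R) :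
  (forall i, P i -> I (F i)) -> I (\sum_(i <- r | P i) F i).
Proof.
by move=> h; elim/big_rec: _ => [|i x Pi Ix]; [apply: ideal0 | apply: idealD => //; apply: h].
Qed.

End Ideals.

Definition span_below (R : nzRingType) (P : nat -> R) (s : nat) (f : R) :=
  exists c : nat -> R, f = \sum_(i < s) c i * P i.

Lemma span_below_ideal (R : comNzRingType) (P : nat -> R) s :
  ideal_pred (span_below P s).
Proof.
split.
- by exists (fun=> 0); rewrite big1 // => i _; rewrite mul0r.
- move=> p q [c ->] [d ->]; exists (fun i => c i + d i).
  by rewrite -big_split; apply: eq_bigr => i _; rewrite mulrDl.
- move=> p q [c ->]; exists (fun i => p * c i).
  by rewrite mulr_sumr; apply: eq_bigr => i _; rewrite mulrA.
Qed.

Lemma span_below_mono (R : nzRingType) (P : nat -> R) s t f :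
  (s <= t)%N -> span_below P s f -> span_below P t f.
Proof.
move=> st [c ->]; exists (fun i => if (i < s)%N then c i else 0).
rewrite (big_ord_widen t (fun i => c i * P i) st) big_mkcond.
by apply: eq_bigr => i _; case: ifP => // _; rewrite mul0r.
Qed.

Lemma mem_span_below (R : nzRingType) (P : nat -> R) s : span_below P s.+1 (P s).
Proof.
exists (fun i => (i == s)%:R); rewrite big_ord_recr /= eqxx mul1r big1 ?add0r //.
by move=> i _; rewrite ltn_eqF // mul0r.
Qed.

Section Hilbert.
Context {K : fieldType} {n : nat}.
Local Notation S := {mpoly K[n]}.

Lemma min_mlead (A : S -> Prop) : (exists p, A p) ->
  exists2 p, A p & forall q, A q -> (mlead p <= mlead q)%O.
Proof.
move=> [p0 Ap0]; apply: contrapT => hno; elim/mleadrect: p0 Ap0 => p IH Ap.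
apply: hno; exists p => // q Aq; rewrite leNgt; apply/negP => /IH; exact.
Qed.

(* With J_s the ideal of P_0, ..., P_(s-1), if the theorem fails, elements of J_(s+1) \ J_s with
   minimal leading monomials contradict Dickson's lemma. *)
Theorem hilbert_basis (P : nat -> S) : exists s, span_below P s (P s).
Proof.
apply: contrapT => /forallNP hno.
have hQ s : exists q, [/\ span_below P s.+1 q, ~ span_below P s q &
    forall q', span_below P s.+1 q' -> ~ span_below P s q' -> (mlead q <= mlead q')%O].
  have [|q [q1 q2] qmin] := @min_mlead (fun q => span_below P s.+1 q /\ ~ span_below P s q).
    by exists (P s); split; [apply: mem_span_below|apply: hno].
  by exists q; split=> // q' *; apply: qmin.
have [Q hQ'] := choice hQ.
have [i [j [ij le]]] := dickson (fun s => mlead (Q s)).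
have [Qi1 Qi2 _] := hQ' i; have [Qj1 Qj2 Qjmin] := hQ' j.
have nzi : Q i != 0 by apply/eqP => e; apply: Qi2; rewrite e; apply: ideal0 (span_below_ideal P i).
have nzj : Q j != 0 by apply/eqP => e; apply: Qj2; rewrite e; apply: ideal0 (span_below_ideal P j).
(* This multiple of [Q i] has the leading term of [Q j] and lies in the ideal of the first [j]
   elements, so [Q j - p] contradicts the minimality of [Q j]. *)
set p := ((mleadc (Q j) / mleadc (Q i)) *: 'X_[mlead (Q j) - mlead (Q i)]) * Q i.
have Ij := span_below_ideal P j.
have Ip : span_below P j p.
  by apply: idealMl => //; apply: span_below_mono Qi1.
have lci : mleadc (Q i) != 0 by rewrite mleadc_eq0.
have lcj : mleadc (Q j) != 0 by rewrite mleadc_eq0.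
have cnz : mleadc (Q j) / mleadc (Q i) != 0 by rewrite mulf_neq0 ?invr_eq0.
have Xnz : 'X_[K, mlead (Q j) - mlead (Q i)] != 0.
  by rewrite -msize_poly_eq0 msizeX.
have mlpE : mlead p =
    (mlead ((mleadc (Q j) / mleadc (Q i)) *: 'X_[mlead (Q j) - mlead (Q i)]) + mlead (Q i))%MM.
  by rewrite /p mleadM ?scaler_eq0 ?negb_or ?cnz.
have mlp : mlead p = mlead (Q j) by rewrite mlpE mleadZ // mleadXm submK.
have lcp : mleadc p = mleadc (Q j).
  by rewrite mlpE mleadcM mleadcZE mleadXm mcoeffX eqxx mulr1 divfK.
set q := Q j - p.
have nIq : ~ span_below P j q.
  by move=> Iq; apply: Qj2; rewrite -(subrK p (Q j)); apply: idealD.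
have Iq : span_below P j.+1 q.
  by apply: (idealB (span_below_ideal P j.+1)) => //; apply: span_below_mono Ip.
have := Qjmin _ Iq nIq; rewrite leNgt => /negP; apply.
have qle : (mlead q <= mlead (Q j))%O.
  by apply: le_trans (mleadB_le _ _) _; rewrite mlp joinxx.
rewrite lt_neqAle qle andbT; apply/eqP => e.
have qz : q@_(mlead q) = 0 by rewrite e mcoeffB -{2}mlp lcp subrr.
apply: nIq; move/eqP: qz; rewrite mleadc_eq0 => /eqP ->; exact: ideal0.
Qed.

End Hilbert.

(** Noetherian induction, used for ideals under reverse inclusion and for closed sets under
    inclusion. *)
Lemma no_descent_minimal (T : Type) (lt : T -> T -> Prop) (A : T -> Prop) :
  (forall u : nat -> T, ~ forall i, lt (u i.+1) (u i)) ->
  (exists x, A x) -> exists2 x, A x & forall y, A y -> ~ lt y x.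
Proof.
move=> hno [x0 Ax0]; apply: contrapT => hmin.
have step (x : {x | A x}) : {y : {y | A y} | lt (sval y) (sval x)}.
  apply: cid; case: x => x Ax /=; apply: contrapT => h; apply: hmin.
  by exists x => // y Ay ltyx; apply: h; exists (exist _ y Ay).
have [u [_ hu]] := dependent_choice step (exist _ x0 Ax0).
exact: (hno (sval \o u)).
Qed.

(** * The Nullstellensatz *)

(* The point with last coordinate x: [muni] singles out the last variable. *)
Definition rcons_point (T : Type) (n : nat) (v : 'I_n -> T) (x : T) : 'I_n.+1 -> T :=
  fun i => if unlift ord_max i is Some j then v j else x.

Lemma rcons_point_max T n (v : 'I_n -> T) x : rcons_point v x ord_max = x.
Proof. by rewrite /rcons_point unlift_none. Qed.

Lemma widen_lift_max n (i : 'I_n) : widen_ord (leqnSn n) i = lift ord_max i.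
Proof. by apply: val_inj; rewrite /= /bump leqNgt ltn_ord. Qed.

Lemma rcons_point_widen T n (v : 'I_n -> T) x i :
  rcons_point v x (widen_ord (leqnSn n) i) = v i.
Proof. by rewrite /rcons_point widen_lift_max liftK. Qed.

Section Muni.
Context {K : fieldType} {n : nat}.

Lemma muni_eval (p : {mpoly K[n.+1]}) v x :
  (map_poly (meval v) (muni p)).[x] = p.@[rcons_point v x].
Proof.
rewrite muniE [RHS]mevalE rmorph_sum horner_sum; apply: eq_bigr => m _.
rewrite /= map_polyZ /= hornerZ mevalZ mevalX map_polyXn hornerXn -mulrA big_ord_recr /= rcons_point_max; congr (_ * (_ * _)).
by apply: eq_bigr => i _; rewrite rcons_point_widen mnmE.
Qed.

Definition mnm_rcons (m : 'X_{1..n}) (k : nat) : 'X_{1..n.+1} :=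
  [multinom rcons_point m k i | i < n.+1].

Lemma coef_muni (p : {mpoly K[n.+1]}) m k : (muni p)`_k@_m = p@_(mnm_rcons m k).
Proof.
rewrite muniE coef_sum (raddf_sum (mcoeff m)) /= [in RHS](mpolyE p) (raddf_sum (mcoeff _)) /=; apply: eq_bigr => m' _.
rewrite coefZ coefXn mulr_natr mcoeffMn !mcoeffZ !mcoeffX -mulrnAr -mulrnA mulnb.
congr (_ * (nat_of_bool _)%:R); apply/andP/eqP => [[/eqP e1 /eqP e2]|->].
  apply/mnmP => i; rewrite mnmE /rcons_point; case: unliftP => [j|] ->; last by rewrite e2.
  by rewrite -e1 mnmE widen_lift_max.
by split; apply/eqP; [apply/mnmP => i; rewrite !mnmE rcons_point_widen|rewrite mnmE rcons_point_max].
Qed.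

Lemma mnm_rcons_eta (m : 'X_{1..n.+1}) :
  m = mnm_rcons [multinom m (widen_ord (leqnSn n) i) | i < n] (m ord_max).
Proof.
apply/mnmP => i; rewrite mnmE /rcons_point; case: unliftP => [j|] -> //.
by rewrite mnmE widen_lift_max.
Qed.

Lemma muni_inj : injective (@muni n K).
Proof.
move=> p q e; apply/mpolyP => m; rewrite (mnm_rcons_eta m) -!coef_muni.
by rewrite e.
Qed.

Lemma muni_mwiden (p : {mpoly K[n]}) : muni (mwiden p) = p%:P.
Proof.
apply/polyP => k; apply/mpolyP => m; rewrite coef_muni coefC.
have -> : mnm_rcons m k = (mnmwiden m + U_(ord_max) *+ k)%MM.
  apply/mnmP => i; rewrite mnmE /rcons_point mnmDE mulmnE mnm1E.
  case: unliftP => [j|] ->.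
    by rewrite -widen_lift_max mnmwiden_widen widen_lift_max (negPf (neq_lift _ _)) mul0n addn0.
  by rewrite mnmwiden_ordmax eqxx mul1n.
case: k => [|k]; first by rewrite mulm0n addm0 mwiden_mnmwiden.
rewrite mcoeff0 (mwidenE (leqnn _)) raddf_sum big1 // => i _ /=.
rewrite mcoeffZ mcoeffX; case: eqP => [/mnmP/(_ ord_max)|]; last by rewrite mulr0.
by rewrite mnmDE mulmnE mnm1E eqxx mul1n !mnmwiden_ordmax.
Qed.

Lemma muni_Xmax : muni 'X_ord_max = 'X :> {poly {mpoly K[n]}}.
Proof.
apply/polyP => k; apply/mpolyP => m; rewrite coef_muni coefX mcoeffX.
case: (eqVneq k 1%N) => [->|nk].
  rewrite mcoeff1; congr ((nat_of_bool _)%:R); apply/eqP/eqP => [/mnmP h|->].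
    apply/mnmP => i; have := h (widen_ord (leqnSn n) i).
    rewrite mnm1E mnmE rcons_point_widen => <-.
    by rewrite widen_lift_max (negPf (neq_lift _ _)) mnm0E.
  apply/mnmP => i; rewrite mnm1E mnmE /rcons_point; case: unliftP => [j|] ->.
    by rewrite (negPf (neq_lift _ _)) mnm0E.
  by rewrite eqxx.
rewrite mcoeff0 (_ : (_ == _) = false) //; apply/negP => /eqP/mnmP/(_ ord_max).
by rewrite mnm1E mnmE rcons_point_max eqxx => e; rewrite -e eqxx in nk.
Qed.

Lemma mmultiK : cancel (@mmulti n K) (@muni n K).
Proof.
move=> p; rewrite /mmulti rmorph_sum -[RHS]coefK poly_def; apply: eq_bigr => i _.
by rewrite rmorphM rmorphXn /= muni_mwiden muni_Xmax mul_polyC.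
Qed.

End Muni.
Record prime_pred (R : nzRingType) (I : R -> Prop) : Prop := PrimePred {
  prime_ideal : ideal_pred I;
  prime1 : ~ I 1;
  primeM : forall p q, I (p * q) -> I p \/ I q }.

Section PrimeIdeals.
Context {R : comNzRingType} {I : R -> Prop} (hI : prime_pred I).

Lemma primeX p k : I (p ^+ k) -> I p.
Proof.
elim: k => [|k IH]; first by rewrite expr0 => /(prime1 hI).
by rewrite exprS => /(primeM hI)[|/IH].
Qed.

End PrimeIdeals.

(** * Prime ideals of R[X] over their contraction to R *)

Section PolyIdeals.
Context {R : idomainType} {I : {poly R} -> Prop} (hI : prime_pred I).
Let I0 := prime_ideal hI.

Definition contraction : R -> Prop := fun r => I r%:P.

Lemma contraction_prime : prime_pred contraction.
Proof.
split; [split|by rewrite /contraction polyC1; apply: prime1 hI|].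
- by rewrite /contraction polyC0; apply: ideal0 I0.
- by move=> p q Ip Iq; rewrite /contraction polyCD; apply: (idealD I0).
- by move=> p q Iq; rewrite /contraction polyCM; apply: (idealMl I0).
- by move=> p q; rewrite /contraction polyCM => /(primeM hI).
Qed.
Let P0 := prime_ideal contraction_prime.

(** With P the contraction of I, this is P[X]. The statement [extended (p - q)] is equality in
    (R/P)[X], which avoids building R/P and its fraction field. *)
Definition extended (r : {poly R}) := forall i, contraction r`_i.

Lemma extended_ideal : ideal_pred extended.
Proof.
split.
- by move=> i; rewrite coef0; apply: (ideal0 P0).
- by move=> p q hp hq i; rewrite coefD; apply: (idealD P0).
- by move=> p q hq i; rewrite coefM; apply: (ideal_sum P0) => j _; apply: (idealMl P0).
Qed.

Lemma extended_sub r : extended r -> I r.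
Proof.
move=> h; rewrite -[r]coefK poly_def; apply: (ideal_sum I0) => i _.
by rewrite -mul_polyC; apply: (idealMr I0); apply: h.
Qed.

Section Minimal.
Context (J : {poly R} -> Prop) (hJ : ideal_pred J) (IJ : forall p, I p -> J p).

(** Dropping the top terms with coefficients in P gives a representative of the same class in
    (R/P)[X] with the true degree. *)
Lemma truncate_contraction p : ~ extended p -> exists q,
  [/\ extended (p - q), (size q <= size p)%N & ~ contraction (lead_coef q)].
Proof.
move=> /existsNP[i0 hi0].
have ex : exists i, `[< ~ contraction p`_i >] by exists i0; apply/asboolP.
have ub i : `[< ~ contraction p`_i >] -> (i <= size p)%N.
  move=> /asboolP h; rewrite leqNgt; apply/negP => lt; apply: h.
  by rewrite nth_default ?(ltnW lt) //; apply: (ideal0 P0).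
case: (ex_maxnP ex ub) => m /asboolP hm mmax.
have pm : p`_m != 0 by apply/eqP => e; apply: hm; rewrite e; apply: (ideal0 P0).
exists (\poly_(i < m.+1) p`_i); rewrite lead_coef_poly // size_poly_eq //; split=> //.
  move=> i; rewrite coefB coef_poly ltnS; case: leqP => [_|lt].
    by rewrite subrr; apply: (ideal0 P0).
  rewrite subr0; apply: contrapT => h.
  by have := mmax i (asboolT h); rewrite leqNgt lt.
by rewrite ltnNge; apply: contra pm => /leq_sizeP/(_ m (leqnn m)) ->.
Qed.

(** Over the fraction field of R/P the ideal J becomes principal; [f] represents a generator, found
    as an element of least degree. *)
Lemma minimal_lead : (exists2 p, J p & ~ extended p) -> exists f,
  [/\ J f, ~ contraction (lead_coef f) &
      forall p, J p -> (size p < size f)%N -> extended p].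
Proof.
have strip p : J p -> ~ extended p -> exists q,
    [/\ J q, (size q <= size p)%N & ~ contraction (lead_coef q)].
  move=> Jp /truncate_contraction[q [h1 h2 h3]]; exists q; split=> //.
  by rewrite -(subKr p q); apply: (idealB hJ) => //; apply/IJ/extended_sub.
move=> [p Jp /strip[] // q [Jq _ hq]].
have ex : exists s, `[< exists f, [/\ J f, ~ contraction (lead_coef f) & size f = s] >].
  by exists (size q); apply/asboolP; exists q.
case: (ex_minnP ex) => s /asboolP[f [Jf hf <-]] smin.
exists f; split=> // g Jg ltg; apply: contrapT => /strip[] // g' [Jg' le hg'].
have /smin : `[< exists f, [/\ J f, ~ contraction (lead_coef f) & size f = size g'] >].
  by apply/asboolP; exists g'.
by rewrite leqNgt (leq_ltn_trans le ltg).
Qed.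

(** Pseudo-division, with powers of the leading coefficient in place of denominators: the remainder
    is in J and too short to be nonzero modulo P. *)
Lemma divide_minimal f p :
    J f -> ~ contraction (lead_coef f) ->
    (forall p, J p -> (size p < size f)%N -> extended p) -> J p ->
  exists k q, extended (lead_coef f ^+ k *: p - q * f) /\
    (size (lead_coef f ^+ k *: p - q * f)%R < size f)%N.
Proof.
move=> Jf lf fmin Jp; exists (scalp p f), (p %/ f).
have -> : lead_coef f ^+ scalp p f *: p - p %/ f * f = p %% f.
  by rewrite Pdiv.Idomain.divp_eq addrAC subrr add0r.
have fnz : f != 0.
  by apply/eqP => e; apply: lf; rewrite e lead_coef0; apply: (ideal0 P0).
have lt : (size (p %% f)%R < size f)%N by rewrite Pdiv.Idomain.ltn_modp.
split=> //; apply: fmin => //.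
have -> : p %% f = lead_coef f ^+ scalp p f *: p - p %/ f * f.
  by rewrite Pdiv.Idomain.divp_eq addrAC subrr add0r.
by apply: (idealB hJ); [rewrite -mul_polyC|]; apply: (idealMl hJ).
Qed.

End Minimal.

(* Elimination without resultants: where s does not vanish, no root of f is a root of g, and where
   lead_coef f does not vanish every root of f is a zero of I. *)
Lemma prime_poly_relation g : ~ I g -> ~ (forall p, I p -> extended p) ->
  exists f : {poly R}, [/\ (1 < size f)%N, ~ contraction (lead_coef f),
    forall p, I p -> exists k q, extended (lead_coef f ^+ k *: p - q * f) &
    exists2 s, ~ contraction s & exists h h', extended (s%:P - h * f - h' * g)].
Proof.
move=> Ig /existsNP[p0 /not_implyP[Ip0 np0]].
have E0 := extended_ideal.
have [|f [If lf fmin]] := minimal_lead I0 (fun _ => id); first by exists p0.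
have fdiv p := @divide_minimal I I0 f p If lf fmin.
have f1 : (1 < size f)%N.
  rewrite ltnNge; apply/negP => /size1_polyC e; apply: lf.
  by rewrite e lead_coefC /contraction -e.
(* The ideal generated by I and [g]. *)
pose J p := exists h, I (p - h * g).
have hJ : ideal_pred J.
  split.
  - by exists 0; rewrite mul0r subr0; apply: (ideal0 I0).
  - move=> p q [h hp] [h' hq]; exists (h + h').
    by rewrite mulrDl opprD addrACA; apply: (idealD I0).
  - by move=> p q [h hq]; exists (p * h); rewrite -mulrA -mulrBr; apply: (idealMl I0).
have IJ p : I p -> J p by exists 0; rewrite mul0r subr0.
have [|f' [Jf' lf' fmin']] := minimal_lead hJ IJ; first by exists p0 => //; apply: IJ.
have fdiv' p := @divide_minimal J hJ f' p Jf' lf' fmin'.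
have contrX r k p : ~ contraction r -> I (r ^+ k *: p) -> I p.
  move=> nr; rewrite -mul_polyC rmorphXn => /(primeM hI)[|//].
  by move=> /(primeX hI).
(* Over the fraction field of R/P, [f] generates a prime ideal and [f'] divides it. Were [f'] not a
   unit, it would lie in I, and so would its multiple [g]. *)
have f'1 : (size f' <= 1)%N.
  rewrite leqNgt; apply/negP => f'1.
  have [k [q [hr sr]]] := fdiv' _ (IJ _ If).
  have Iqf : I (q * f').
    rewrite -(subKr (lead_coef f' ^+ k *: f) (q * f')); apply: (idealB I0).
      by rewrite -mul_polyC; apply: (idealMl I0).
    exact: extended_sub.
  case: (primeM hI Iqf) => [Iq|If'].
    have lf'nz : lead_coef f' != 0.
      by apply/eqP => e; apply: lf'; rewrite e; apply: (ideal0 P0).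
    have Eq : extended q.
      have [->|qnz] := eqVneq q 0; first exact: (ideal0 E0).
      apply: fmin => //.
      have f'nz : f' != 0 by rewrite -lead_coef_eq0.
      have : (size (q * f')%R <= size f)%N.
        rewrite -(subKr (lead_coef f' ^+ k *: f) (q * f')).
        apply: leq_trans (size_polyD _ _) _; rewrite size_polyN geq_max size_scale_leq /=.
        apply: ltnW; apply: leq_trans sr _.
        by rewrite leqNgt; apply/negP => /(fmin' _ (IJ _ If)) h; apply: lf; apply: h.
      rewrite size_mul //; have := size_poly_gt0 q; rewrite qnz.
      by move: f'1; set a := size f'; set b := size q; set c := size f; lia.
    have : extended (lead_coef f' ^+ k *: f).
      rewrite -[X in extended X](subrK (q * f')); apply: (idealD E0) => //.
      by apply: (idealMr E0).
    move=> /(_ (size f).-1); rewrite coefZ -lead_coefE => /(primeM contraction_prime)[|//].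
    by move=> /(primeX contraction_prime).
  have [|k' [q' [hr' _]]] := fdiv' g; first by exists 1; rewrite mul1r subrr; apply: (ideal0 I0).
  apply: Ig; apply: (contrX (lead_coef f') k') => //.
  rewrite -[X in I X](subrK (q' * f')); apply: (idealD I0); first exact: extended_sub.
  exact: (idealMl I0).
case: Jf' => h Ih; have [k [q [hr _]]] := fdiv _ Ih.
exists f; split=> //.
  by move=> p Ip; have [k' [q' [hr' _]]] := fdiv p Ip; exists k', q'.
exists (lead_coef f ^+ k * lead_coef f').
  by move=> /(primeM contraction_prime)[/(primeX contraction_prime)|].
exists q, ((lead_coef f ^+ k)%:P * h).
suff -> : (lead_coef f ^+ k * lead_coef f')%:P - q * f - (lead_coef f ^+ k)%:P * h * g =
  lead_coef f ^+ k *: (f' - h * g) - q * f by [].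
rewrite -mul_polyC [in RHS](size1_polyC f'1) [in LHS](size1_polyC f'1) lead_coefC polyCM; ring.
Qed.

End PolyIdeals.

Lemma closed_nonroot (K : closedFieldType) (p : {poly K}) : p != 0 -> exists x, p.[x] != 0.
Proof. by move=> /closed_nonrootP. Qed.

(** Induction on the number of variables: a zero [v] of the contraction is lifted along the last
    coordinate. If I is extended, the whole line over [v] consists of zeros and a non-root of [g] on
    it suffices. *)
Theorem prime_has_point (K : closedFieldType) n (I : {mpoly K[n]} -> Prop) g :
  prime_pred I -> ~ I g ->
  exists2 v, (forall p, I p -> p.@[v] = 0) & g.@[v] != 0.
Proof.
elim: n I g => [|n IH] I g hI Ig.
  have memC c : I c%:MP -> c = 0.
    move=> Ic; apply/eqP; rewrite -[_ == _]negbK; apply/negP => cnz; apply: (prime1 hI).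
    rewrite -[1]mpolyC1 -(mulVf cnz) mpolyCM; exact: idealMl (prime_ideal hI) _ _ Ic.
  exists (fun=> 0) => [p|].
    by rewrite -(mpolyKC p) mevalC; apply: memC.
  rewrite -(mpolyKC g) mevalC; apply/eqP => e; apply: Ig; rewrite -(mpolyKC g) e mpolyC0.
  exact: ideal0 (prime_ideal hI).
pose I' := fun p : {poly {mpoly K[n]}} => exists2 q, I q & muni q = p.
have I'E p : I' (muni p) <-> I p.
  by split=> [[q Iq /muni_inj <-]|]; [|exists p].
have I0 := prime_ideal hI.
have hI' : prime_pred I'.
  split; [split|..].
  - by rewrite -(rmorph0 (@muni n K)); apply/I'E; exact: ideal0 I0.
  - by move=> _ _ [p Ip <-] [q Iq <-]; rewrite -rmorphD; apply/I'E; apply: idealD I0 _ _ _ _.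
  - by move=> p _ [q Iq <-]; rewrite -(mmultiK p) -rmorphM; apply/I'E; apply: idealMl I0 _ _ _.
  - by rewrite -(rmorph1 (@muni n K)) => /I'E; exact: prime1 hI.
  - by move=> p q; rewrite -(mmultiK p) -(mmultiK q) -rmorphM => /I'E/(primeM hI)[] ?;
      [left|right]; apply/I'E.
have I'g : ~ I' (muni g) by move=> /I'E.
have hP := contraction_prime hI'.
suff [v vP [x xI xg]] : exists2 v : 'I_n -> K, (forall r, @contraction _ I' r -> r.@[v] = 0) &
    exists2 x, (forall p, I' p -> (map_poly (meval v) p).[x] = 0) &
      (map_poly (meval v) (muni g)).[x] != 0.
  exists (rcons_point v x) => [p Ip|]; rewrite -muni_eval //.
  by apply: xI; apply/I'E.
have ext0 v r : (forall r, @contraction _ I' r -> r.@[v] = 0) -> @extended _ I' r ->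
    map_poly (meval v) r = 0.
  by move=> vP hr; apply/polyP => i; rewrite coef_map coef0; apply: vP; apply: hr.
have [hext|hext] := pselect (forall p, I' p -> @extended _ I' p).
  have /existsNP[i hi] : ~ @extended _ I' (muni g) by move=> /(extended_sub hI').
  have [v vP vg] := IH _ _ hP hi; exists v => //.
  have [|x xg] := closed_nonroot (p := map_poly (meval v) (muni g)).
    by apply: contraNneq vg => e; move: (congr1 (fun p : {poly K} => p`_i) e); rewrite coef_map coef0 => ->.
  by exists x => // p /hext hp; rewrite ext0 // horner0.
have [f [f1 lf fdiv [s Ps [h [h' hs]]]]] := prime_poly_relation hI' I'g hext.
(* Choosing [v] off this product keeps the degree of [f] at [v] positive, so a root [x] exists, and
   the relation for [s] then prevents [g] from vanishing at it. *)
have Pls : ~ @contraction _ I' (lead_coef f * s) by move=> /(primeM hP)[].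
have [v vP] := IH _ _ hP Pls; rewrite rmorphM mulf_eq0 negb_or => /andP[vl vs].
exists v => //.
have sf : size (map_poly (meval v) f) = size f by rewrite size_poly_eq.
have /closed_rootP[x /rootP xf] : size (map_poly (meval v) f) != 1%N by rewrite sf neq_ltn f1 orbT.
exists x => [p /fdiv[k [q /(ext0 v _ vP)]]|].
  rewrite rmorphB rmorphM /= => /(congr1 (horner^~ x)).
  rewrite hornerD hornerN hornerM xf mulr0 subr0 horner0 map_polyZ /= rmorphXn hornerZ.
  by move/eqP; rewrite mulf_eq0 expf_eq0 (negPf vl) andbF => /eqP.
have := ext0 v _ vP hs; rewrite !rmorphB !rmorphM /= map_polyC /= => /(congr1 (horner^~ x)).
rewrite !hornerE xf mulr0 subr0 => e; apply: contraNneq vs => eg.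
by apply/eqP; rewrite eg mulr0 subr0 in e.
Qed.

Section StrongNullstellensatz.
Context {K : closedFieldType} {n : nat}.
Local Notation S := {mpoly K[n]}.

Lemma no_ascending_ideals (J : nat -> S -> Prop) : (forall i, ideal_pred (J i)) ->
  ~ forall i, (forall p, J i p -> J i.+1 p) /\ exists2 p, J i.+1 p & ~ J i p.
Proof.
move=> hJ hasc; have mono i j p : (i <= j)%N -> J i p -> J j p.
  move=> /subnK <-; elim: (_ - _)%N => // k IH /IH; exact: (proj1 (hasc _)).
have /choice[P hP] i : exists p, J i.+1 p /\ ~ J i p by have [_ [p]] := hasc i; exists p.
have [s [c e]] := hilbert_basis P; apply: (proj2 (hP s)); rewrite e.
apply: (ideal_sum (hJ s)) => i _; apply: (idealMl (hJ s)).
by apply: (mono i.+1) => //; apply: (proj1 (hP i)).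
Qed.

(** An ideal maximal among those containing I and no power of F is prime: adjoining any outside
    element captures a power of F, and two such captures multiply. *)
Lemma prime_avoiding_powers (I : S -> Prop) F : ideal_pred I -> (forall k, ~ I (F ^+ k)) ->
  exists M, [/\ prime_pred M, forall p, I p -> M p & ~ M F].
Proof.
move=> hI hF.
pose T := {J : S -> Prop | ideal_pred J}.
pose A (J : T) := (forall p, I p -> sval J p) /\ forall k, ~ sval J (F ^+ k).
pose lt (J' J : T) := (forall p, sval J p -> sval J' p) /\ exists2 p, sval J' p & ~ sval J p.
have hasc (u : nat -> T) : ~ forall i, lt (u i.+1) (u i).
  exact: no_ascending_ideals (fun i => svalP (u i)).
have [|M [IM MF] Mmax] := @no_descent_minimal T lt A hasc.
  by exists (exist _ I hI); split.
have hM := svalP M; set M0 := sval M in hM IM MF *.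
have key p : ~ M0 p -> exists k a, M0 (F ^+ k - a * p).
  move=> Mp; apply: contrapT => hno.
  have hJ : ideal_pred (fun q => exists a, M0 (q - a * p)).
    split.
    - by exists 0; rewrite mul0r subr0; apply: ideal0.
    - move=> q r [a ha] [b hb]; exists (a + b).
      by rewrite mulrDl opprD addrACA; apply: idealD.
    - by move=> q r [a ha]; exists (q * a); rewrite -mulrA -mulrBr; apply: idealMl.
  have sub q : M0 q -> exists a, M0 (q - a * p) by exists 0; rewrite mul0r subr0.
  apply: (Mmax (exist _ _ hJ)); split=> //=.
  - by move=> q /IM /sub.
  - by move=> k [a ha]; apply: hno; exists k, a.
  - by exists p => //; exists 1; rewrite mul1r subrr; apply: ideal0.
exists M0; split=> //; last by move=> MF1; apply: (MF 1%N).
split=> //; first by move=> M1; apply: (MF 0%N).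
move=> p q Mpq; apply: contrapT => /not_orP[/key[k [a ha]] /key[l [b hb]]].
apply: (MF (k + l)%N).
have -> : F ^+ (k + l) = F ^+ l * (F ^+ k - a * p) + a * p * (F ^+ l - b * q) + a * b * (p * q).
  by rewrite exprD; ring.
by do 2?apply: idealD => //; apply: idealMl.
Qed.

Theorem nullstellensatz (I : S -> Prop) F : ideal_pred I ->
  (forall v, (forall p, I p -> p.@[v] = 0) -> F.@[v] = 0) -> exists k, I (F ^+ k).
Proof.
move=> hI hv; apply: contrapT => /forallNP hF.
have [M [hM IM MF]] := prime_avoiding_powers hI hF.
have [v vM] := prime_has_point hM MF; rewrite hv ?eqxx // => p /IM; exact: vM.
Qed.

End StrongNullstellensatz.

(** * Algebraic independence and finiteness *)

Lemma linear_dependency (K : fieldType) (I J : finType) (M : I -> J -> K) :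
  (#|J| < #|I|)%N -> exists2 w : I -> K, exists i, w i != 0 &
    forall j, \sum_i w i * M i j = 0.
Proof.
move=> lt; pose A := \matrix_(i < #|I|, j < #|J|) M (enum_val i) (enum_val j).
have : kermx A != 0.
  by rewrite -mxrank_eq0 mxrank_ker subn_eq0 -ltnNge (leq_ltn_trans (rank_leq_col A)).
case/rowV0Pn => w /sub_kermxP wA /eqP wn0.
have /existsNP[i /eqP wi] : ~ forall i, w 0 i = 0 by move=> h; apply: wn0; apply/rowP => i; rewrite mxE h.
exists (fun i => w 0 (enum_rank i)); first by exists (enum_val i); rewrite enum_valK.
move=> j; have := congr1 (fun B : 'rV_#|J| => B 0 (enum_rank j)) wA.
rewrite !mxE (reindex (@enum_rank I)) /=; last by apply: onW_bij; apply: enum_rank_bij.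
by move=> e; rewrite -[RHS]e; apply: eq_bigr => k _; rewrite mxE !enum_rankK.
Qed.

Definition values (K : fieldType) n m (H : 'I_m -> {mpoly K[n]}) (v : 'I_n -> K) : 'I_m -> K :=
  fun j => (H j).@[v].

(** Here and in [module_finite], functions on the point set [C] replace its coordinate ring, so no
    quotient is formed. *)
Definition alg_indep (K : fieldType) n m (C : set ('I_n -> K)) (H : 'I_m -> {mpoly K[n]}) : Prop :=
  forall b : {mpoly K[m]}, (forall v, C v -> b.@[values H v] = 0) -> b = 0.

Definition module_finite (K : fieldType) n m (C : set ('I_n -> K)) (H : 'I_m -> {mpoly K[n]}) : Prop :=
  exists (J : finType) (u : J -> {mpoly K[n]}), forall P, exists c : J -> {mpoly K[m]},
    forall v, C v -> P.@[v] = \sum_j (c j).@[values H v] * (u j).@[v].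

Lemma msizeM_bound (K : fieldType) n (p q : {mpoly K[n]}) a b :
  (msize p <= a)%N -> (msize q <= b)%N -> (msize (p * q) <= a + b)%N.
Proof.
have [->|pn] := eqVneq p 0; first by rewrite mul0r msize0.
have [->|qn] := eqVneq q 0; first by rewrite mulr0 msize0.
by move=> ha hb; rewrite msizeM //; apply: leq_trans (leq_pred _) _; apply: leq_add.
Qed.

Lemma msize_sum_bound (K : fieldType) n (J : finType) (F : J -> {mpoly K[n]}) a :
  (forall j, msize (F j) <= a)%N -> (msize (\sum_j F j) <= a)%N.
Proof.
move=> h; elim/big_rec: _ => [|j x _ hx]; first by rewrite msize0.
by apply: leq_trans (msizeD_le _ _) _; rewrite geq_max h.
Qed.

(** The left side has degree m < k in T. The choice of [E] gives d(kT + 1) <= ET, and T is then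
    taken above rE^m. *)
Lemma power_growth (r d k m : nat) : (m < k)%N ->
  exists T, (r * (d * (k * T).+1) ^ m < T ^ k)%N.
Proof.
move=> mk; pose E := (d * k.+1)%N; exists (r * E ^ m).+1; set T := (r * E ^ m).+1.
have le : (d * (k * T).+1 <= E * T)%N.
  by rewrite /E -mulnA leq_mul2l; apply/orP; right; rewrite mulSn -addn1 addnC leq_add2r.
apply: (@leq_ltn_trans (r * (E * T) ^ m)%N).
  by rewrite leq_mul2l; apply/orP; right; case: (m) => [|m0] //; rewrite leq_exp2r.
rewrite expnMn mulnA; apply: (@leq_trans (T ^ m.+1)%N); last by rewrite leq_pexp2l.
by rewrite expnS ltn_pmul2r ?expn_gt0.
Qed.

Section Counting.
Context {K : fieldType} {n m k : nat} (C : set ('I_n -> K)).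
Context (H : 'I_m -> {mpoly K[n]}) (G : 'I_k -> {mpoly K[n]}).

(* The T^k monomials in G with exponents below T lie in a space spanned by O(T^m) elements. *)
Theorem module_finite_bound : module_finite C H -> alg_indep C G -> (k <= m)%N.
Proof.
move=> [J [u hu]] indG; rewrite leqNgt; apply/negP => mk.
have [c1 hc1] := hu 1.
have /choice[M hM] (ij : 'I_k * J) := hu (G ij.1 * u ij.2).
pose d := maxn (\max_j msize (c1 j)) (\max_ij \max_l msize (M ij l)).
have c1d j : (msize (c1 j) <= d)%N.
  by rewrite leq_max (leq_bigmax (F := fun j => msize (c1 j))).
have Md ij l : (msize (M ij l) <= d)%N.
  rewrite leq_max; apply/orP; right.
  apply: leq_trans (leq_bigmax (F := fun ij => \max_l msize (M ij l)) ij).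
  by rewrite (leq_bigmax (F := fun l => msize (M ij l))).
(* Multiplication by one [G i] acts on the coordinates through the matrix [M], whose entries have
   size at most [d]; hence the growth is linear in the degree [t]. *)
have monom t (g : 'X_{1..k}) : mdeg g = t -> exists p : J -> {mpoly K[m]},
    (forall j, msize (p j) <= d * t.+1)%N /\
    forall v, C v -> 'X_[g].@[values G v] = \sum_j (p j).@[values H v] * (u j).@[v].
  elim: t g => [|t IH] g; first move/eqP.
    rewrite mdeg_eq0 => /eqP ->; exists c1; split=> [j|v Cv]; first by rewrite muln1.
    by rewrite mpolyX0 meval1 -hc1 // meval1.
  move=> gt; have /existsNP[i /eqP gi] : ~ forall i, g i = 0%N.
    by move=> h; have := mdegE g; rewrite gt big1.
  have gE : g = (U_(i) + (g - U_(i)))%MM.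
    by rewrite addmC submK //; apply/mnm_lepP => l; rewrite mnm1E; case: eqP => [<-|//]; rewrite lt0n.
  have [|p [pd hp]] := IH (g - U_(i))%MM.
    by have := congr1 mdeg gE; rewrite mdegD mdeg1 gt; lia.
  exists (fun l => \sum_j p j * M (i, j) l); split.
    by move=> l; apply: msize_sum_bound => j; rewrite mulnS addnC; apply: msizeM_bound.
  move=> v Cv; rewrite gE mpolyXD mevalM mevalXU hp // mulr_sumr.
  under eq_bigr => j _ do rewrite mulrCA -mevalM (hM (i, j)) // mulr_sumr.
  rewrite exchange_big; apply: eq_bigr => l _ /=; rewrite raddf_sum /= mulr_suml.
  by apply: eq_bigr => j _; rewrite mevalM mulrA.
have [T hT] := power_growth #|J| d mk; set D := (d * (k * T).+1)%N in hT.
pose mon (a : {ffun 'I_k -> 'I_T}) : 'X_{1..k} := [multinom (a i : nat) | i < k].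
have mon_inj : injective mon.
  by move=> a b /mnmP e; apply/ffunP => i; apply: val_inj; have := e i; rewrite !mnmE.
have /choice[p hp] (a : {ffun 'I_k -> 'I_T}) := monom _ (mon a) erefl.
have pD a j : (msize (p a j) <= D)%N.
  apply: leq_trans (proj1 (hp a) j) _; rewrite leq_mul2l ltnS mdegE; apply/orP; right.
  have -> : (k * T = \sum_(i < k) T)%N by rewrite sum_nat_const card_ord.
  by apply: leq_sum => i _; rewrite mnmE ltnW.
(* The monomials [mon a] have degree at most kT, so their coordinates involve only exponents below
   [D]: there are T^k monomials and #|J| D^m < T^k coefficients. *)
have [|w [a0 wa0] hw] := @linear_dependency K {ffun 'I_k -> 'I_T} (J * {ffun 'I_m -> 'I_D})%type
    (fun a jc => (p a jc.1)@_[multinom (jc.2 i : nat) | i < m]).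
  by rewrite card_prod !card_ffun !card_ord.
have wp0 j : \sum_a w a *: p a j = 0.
  apply/mpolyP => g; rewrite raddf_sum mcoeff0 /=.
  case: (pselect (forall i, g i < D)%N) => [gD|/existsNP[i /negP]].
    rewrite -[RHS](hw (j, [ffun i => Ordinal (gD i)])); apply: eq_bigr => a _.
    rewrite mcoeffZ /=; congr (_ * _@_ _); apply/mnmP => i; by rewrite mnmE ffunE.
  rewrite -leqNgt => gi; apply: big1 => a _; rewrite mcoeffZ.
  rewrite memN_msupp_eq0 ?mulr0 // msize_mdeg_ge //; apply: leq_trans (pD a j) _.
  by apply: leq_trans gi _; rewrite mdegE (bigD1 i) //= leq_addr.
pose b := \sum_a w a *: 'X_[K, mon a].
have : b = 0.
  apply: indG => v Cv; rewrite raddf_sum /=.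
  under eq_bigr => a _ do rewrite mevalZ (proj2 (hp a)) // mulr_sumr.
  rewrite exchange_big /= big1 // => j _.
  under eq_bigr => a _ do rewrite mulrA -(mevalZ _ (w a) (p a j)).
  by rewrite -mulr_suml -raddf_sum wp0 raddf0 mul0r.
move/(congr1 (mcoeff (mon a0))); rewrite raddf_sum mcoeff0 (bigD1 a0) //= big1.
  by rewrite addr0 mcoeffZ mcoeffX eqxx mulr1 => /eqP; rewrite (negPf wa0).
by move=> a ane; rewrite mcoeffZ mcoeffX inj_eq // (negPf ane) mulr0.
Qed.

End Counting.

(** * Homogeneous components and functions on cones *)

Section Cones.
Context {K : closedFieldType} {n : nat}.
Local Notation S := {mpoly K[n]}.

Lemma meval_scale d (p : S) t v : p \is d.-homog -> p.@[fun i => t * v i] = t ^+ d * p.@[v].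
Proof.
move=> hp; rewrite !mevalE mulr_sumr !big_seq; apply: eq_bigr => m mp.
rewrite mulrCA; congr (_ * _); have /= <- := dhomog_mf hp mp; rewrite mdegE -prodrXr -big_split /=.
by apply: eq_bigr => i _; rewrite exprMn.
Qed.

(** On the line through [v] and the origin, homogeneous components become coefficients; as K is
    infinite, a polynomial vanishing on that line has all its components zero at [v]. *)
Lemma meval_scale_poly (p : S) v : exists2 q : {poly K},
  forall t, q.[t] = p.@[fun i => t * v i] & forall d, q`_d = (pihomog mdeg d p).@[v].
Proof.
exists (\poly_(d < msize p) (pihomog mdeg d p).@[v]).
  move=> t; rewrite horner_poly [in RHS](pihomog_partitionE (leqnn (msize p))) raddf_sum /=.
  by apply: eq_bigr => d _; rewrite (meval_scale _ _ (pihomogP _ _ _)) mulrC.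
move=> d; rewrite coef_poly; case: ltnP => // le; rewrite pihomogE big_seq_cond big1 ?raddf0 //.
move=> m /andP[/msize_mdeg_lt lt /eqP e]; move: lt; rewrite e ltnNge le //.
Qed.

Lemma poly_eq0_horner (q : {poly K}) : (forall t, q.[t] = 0) -> q = 0.
Proof.
by move=> h; apply/eqP; apply/negPn/negP => /closed_nonroot[x]; rewrite h eqxx.
Qed.

Definition is_cone (C : set ('I_n -> K)) := forall t v, C v -> C (fun i => t * v i).

Lemma cone_pihomog C (p : S) : is_cone C -> (forall v, C v -> p.@[v] = 0) ->
  forall d v, C v -> (pihomog mdeg d p).@[v] = 0.
Proof.
move=> hC hp d v Cv; have [q qt <-] := meval_scale_poly p v.
by rewrite (poly_eq0_horner (q := q)) ?coef0 // => t; rewrite qt hp //; apply: hC.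
Qed.

Lemma pihomogM (p H : S) e D : H \is e.-homog ->
  pihomog mdeg D (p * H) = if (e <= D)%N then pihomog mdeg (D - e) p * H else 0.
Proof.
move=> hH; rewrite [in LHS](pihomog_partitionE (leqnn (msize p))) mulr_suml raddf_sum /=.
have hd d : pihomog mdeg d p * H \is (d + e).-homog by apply: dhomogM => //; apply: pihomogP.
have small d : (msize p <= d)%N -> pihomog mdeg d p = 0.
  move=> le; rewrite pihomogE big_seq_cond big1 //.
  by move=> m /andP[/msize_mdeg_lt lt /eqP em]; move: lt; rewrite em ltnNge le.
under eq_bigr => d _.
  rewrite (_ : pihomog _ _ _ = if D == (d + e)%N then pihomog mdeg d p * H else 0); last first.
    case: (eqVneq D (d + e)%N) => [->|ne]; first by rewrite pihomog_dE.
    by rewrite (pihomog_ne0 _ (hd d)) // eq_sym.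
  over.
rewrite -big_mkcond; case: (leqP e D) => [le|lt]; last first.
  by rewrite big_pred0 // => d; apply/negbTE; rewrite neq_ltn (leq_trans lt) ?leq_addl.
case: (ltnP (D - e) (msize p)) => [lt|ge].
  rewrite (big_pred1 (Ordinal lt)) // => d /=; rewrite -val_eqE /=.
  by apply/eqP/eqP; lia.
rewrite small // mul0r big_pred0 // => d; apply/negbTE; apply/eqP => e'.
by have := ltn_ord d; rewrite ltnNge -(addnK e d) -e' ge.
Qed.

Lemma msize_pihomog d (p : S) : (msize (pihomog mdeg d p) <= d.+1)%N.
Proof.
have [->|nz] := eqVneq (pihomog mdeg d p) 0; first by rewrite msize0.
by rewrite -mlead_deg // (dhomog_mf (pihomogP _ _ _) (mlead_supp nz)).
Qed.

Definition represented m (C : set ('I_n -> K)) (H : 'I_m -> S) (J : finType) (u : J -> S) (P : S) :=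
  exists c : J -> {mpoly K[m]},
    forall v, C v -> P.@[v] = \sum_j (c j).@[values H v] * (u j).@[v].

Section Represented.
Context {m : nat} {C : set ('I_n -> K)} {H : 'I_m -> S} {J : finType} {u : J -> S}.

Lemma represented_sum (I : eqType) (r : seq I) (F : I -> S) :
  (forall i, i \in r -> represented C H u (F i)) -> represented C H u (\sum_(i <- r) F i).
Proof.
elim: r => [|i r IH] h.
  by exists (fun=> 0) => v _; rewrite big_nil raddf0 big1 // => j _; rewrite raddf0 mul0r.
have [|c hc] := h i; first by rewrite inE eqxx.
have [|d hd] := IH; first by move=> j jr; apply: h; rewrite inE jr orbT.
exists (fun j => c j + d j) => v Cv; rewrite big_cons mevalD hc // hd // -big_split.
by apply: eq_bigr => j _; rewrite mevalD mulrDl.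
Qed.

Lemma represented_mul (b : {mpoly K[m]}) P Q : represented C H u P ->
  (forall v, C v -> Q.@[v] = b.@[values H v] * P.@[v]) -> represented C H u Q.
Proof.
move=> [c hc] hQ; exists (fun j => b * c j) => v Cv; rewrite hQ // hc // mulr_sumr.
by apply: eq_bigr => j _; rewrite mevalM mulrA.
Qed.

Lemma represented_ext P Q : represented C H u P ->
  (forall v, C v -> Q.@[v] = P.@[v]) -> represented C H u Q.
Proof. by move=> [c hc] hQ; exists c => v Cv; rewrite hQ // hc. Qed.

Lemma represented_gen j : represented C H u (u j).
Proof.
exists (fun i => (i == j)%:R) => v _; rewrite (bigD1 j) //= eqxx big1 ?addr0.
  by rewrite meval1 mul1r.
by move=> i ne; rewrite (negPf ne) raddf0 mul0r.
Qed.

End Represented.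

Theorem module_finite_of_power m (C : set ('I_n -> K)) (H : 'I_m -> S) (e : 'I_m -> nat) D :
  is_cone C -> (forall j, H j \is (e j).-homog) -> (forall j, 0 < e j)%N ->
  (forall i, exists c : 'I_m -> S, forall v, C v ->
     v i ^+ D = \sum_j (c j).@[v] * (H j).@[v]) ->
  module_finite C H.
Proof.
move=> hC hH e0 hpow.
(* Only the component of degree [D - e j] of each cofactor matters on a cone. Since [e j > 0], the
   cofactors then have degree below D. *)
have /choice[c hc] i : exists c : 'I_m -> S, (forall j, msize (c j) <= D)%N /\
    forall v, C v -> v i ^+ D = \sum_j (c j).@[v] * (H j).@[v].
  have [c hc] := hpow i.
  exists (fun j => if (e j <= D)%N then pihomog mdeg (D - e j) (c j) else 0); split.
    move=> j; case: ifP => [le|_]; last by rewrite msize0.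
    apply: leq_trans (msize_pihomog _ _) _; by have := e0 j; lia.
  have h w : C w -> ('X_i ^+ D - \sum_j c j * H j).@[w] = 0.
    move=> Cw; rewrite mevalB rmorphXn /= mevalXU hc // (raddf_sum (meval w)) /=; apply/eqP.
    by rewrite subr_eq0; apply/eqP/eq_bigr => j _; rewrite mevalM.
  move=> v Cv; have := cone_pihomog hC h D Cv.
  rewrite raddfB /= (raddf_sum (pihomog mdeg D)) /= pihomog_dE; last first.
    by have := dhomogMn D (_ : 'X_i \is 1.-homog); rewrite mul1n; apply; rewrite dhomogX /= mdeg1.
  rewrite mevalB rmorphXn /= mevalXU (raddf_sum (meval v)) /= => /eqP; rewrite subr_eq0 => /eqP ->.
  apply: eq_bigr => j _; rewrite (pihomogM _ _ (hH j)); case: ifP => _; first by rewrite mevalM.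
  by rewrite raddf0 mul0r.
pose u (a : {ffun 'I_n -> 'I_D}) : S := 'X_[[multinom (a i : nat) | i < n]].
exists {ffun 'I_n -> 'I_D}, u => P.
(* Monomials with all exponents below D are the generators. In any other one a factor ['X_i ^+ D] is
   replaced by the relation, which leaves cofactors of the [H j] of smaller degree. *)
have [s] := ubnP (msize P); elim: s P => // s IH P; rewrite ltnS => Ps.
rewrite -/(represented C H u P) [P]mpolyE; apply: represented_sum => g gP.
have gs : (mdeg g < s)%N by apply: leq_trans (msize_mdeg_lt gP) Ps.
apply: (@represented_mul _ _ _ _ _ (P@_g)%:MP 'X_[g]); last by move=> v _; rewrite mevalZ mevalC.
case: (pselect (forall i, g i < D)%N) => [gD|/existsNP[i /negP]].
  suff -> : 'X_[g] = u [ffun i => Ordinal (gD i)] by apply: represented_gen.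
  by congr 'X_[_]; apply/mnmP => i; rewrite mnmE ffunE.
rewrite -leqNgt => gi; have [cD hci] := hc i.
have gE : g = ((g - U_(i) *+ D) + U_(i) *+ D)%MM.
  rewrite submK //; apply/mnm_lepP => l; rewrite mulmnE mnm1E.
  by case: eqP => [<-|_]; rewrite ?mul1n.
apply: (@represented_ext _ _ _ _ _ (\sum_j H j * ('X_[g - U_(i) *+ D] * c i j))).
  apply: represented_sum => j _; apply: (@represented_mul _ _ _ _ _ 'X_j ('X_[g - U_(i) *+ D] * c i j)).
    apply: IH; apply: leq_trans gs; rewrite ltnS.
    have [->|cn] := eqVneq (c i j) 0; first by rewrite mulr0 msize0.
    have Xn : 'X_[K, g - U_(i) *+ D] != 0 by rewrite -msize_poly_eq0 msizeX.
    rewrite msizeM // msizeX addSn /= gE mdegD mdegMn mdeg1 mul1n {2}gE addmK leq_add2l //.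
  by move=> v _; rewrite mevalM mevalXU.
move=> v Cv; rewrite [in LHS]gE mpolyXD mevalM -mpolyXn rmorphXn /= mevalXU hci // mulr_sumr.
rewrite raddf_sum /=; apply: eq_bigr => j _; rewrite !mevalM; ring.
Qed.

End Cones.

(** * Projective algebraic sets *)

Section ProjectiveSets.
Context {K : closedFieldType} {N : nat}.
Local Notation PN := (proj_space K N).
Local Notation poly := {mpoly K[N.+1]}.

(* A choice of homogeneous coordinates. *)
Definition coords (p : PN) : 'I_N.+1 -> K := vpick (val p) 0.

Lemma dim_point (p : PN) : \dim (val p) = 1%N.
Proof. exact/eqP/(valP p). Qed.

Lemma coords_span (p : PN) x : x \in val p -> exists t, x 0 = (fun i => t * coords p i).
Proof.
move=> xp; have pn : vpick (val p) != 0.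
  by rewrite vpick0 -dimv_eq0 dim_point.
have e : val p = <[vpick (val p)]>%VS.
  by apply/eqP; rewrite eq_sym eqEdim -memvE memv_pick dim_vline pn dim_point.
move: xp; rewrite e => /vlineP[t ->]; exists t; apply/funext => i.
by rewrite mxE.
Qed.

Lemma coords_neq0 (p : PN) : exists i, coords p i != 0.
Proof.
have : vpick (val p) != 0 by rewrite vpick0 -dimv_eq0 dim_point.
by case/rV0Pn => i; exists i.
Qed.

Lemma vanishes_coords d (F : poly) p : F \is d.-homog -> vanishes_at F p <-> F.@[coords p] = 0.
Proof.
move=> hF; split=> [h|h x /coords_span[t ->]]; first exact: (h _ (memv_pick _)).
by rewrite (meval_scale _ _ hF) h mulr0.
Qed.

Lemma point_of (v : 'I_N.+1 -> K) : (exists i, v i != 0) -> exists p : PN,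
  exists2 t, t != 0 & coords p = (fun i => t * v i).
Proof.
move=> [i vi]; pose x : 'rV[K]_N.+1 := \row_i v i.
have xn : x != 0 by apply/rV0Pn; exists i; rewrite mxE.
have d1 : \dim <[x]>%VS = 1%N by rewrite dim_vline xn.
exists (exist _ <[x]>%VS (introT eqP d1)).
have : vpick <[x]>%VS \in <[x]>%VS by apply: memv_pick.
case/vlineP => t et; exists t.
  apply/eqP => t0; move: et; rewrite t0 scale0r => /eqP.
  by rewrite vpick0 -dimv_eq0 d1.
by apply/funext => j; rewrite /coords /= et !mxE.
Qed.

Definition cone (Y : set PN) : set ('I_N.+1 -> K) :=
  [set v | exists2 p, Y p & exists t, v = (fun i => t * coords p i)].

Lemma cone_is_cone Y : is_cone (cone Y).
Proof.
move=> t _ [p Yp [s ->]]; exists p => //; exists (t * s).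
by apply/funext => i; rewrite mulrA.
Qed.

Lemma cone_coords (Y : set PN) p : Y p -> cone Y (coords p).
Proof. by move=> Yp; exists p => //; exists 1; apply/funext => i; rewrite mul1r. Qed.

Lemma cone_sub (Y Z : set PN) : Y `<=` Z -> cone Y `<=` cone Z.
Proof. by move=> YZ v [p /YZ Zp h]; exists p. Qed.

Lemma vanish_cone d (F : poly) (Y : set PN) : F \is d.-homog ->
  Y `<=` zeros F <-> forall v, cone Y v -> F.@[v] = 0.
Proof.
move=> hF; split=> [h v [p /h/(vanishes_coords _ hF) e [t ->]]|h p Yp].
  by rewrite (meval_scale _ _ hF) e mulr0.
by apply/(vanishes_coords _ hF)/h/cone_coords.
Qed.

Lemma zeros_algebraic (F : poly) : is_homog F -> algebraic_set (zeros F).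
Proof.
move=> hF; exists [set F]; first by move=> _ ->.
by rewrite bigcap_set1.
Qed.

Lemma algebraicP (Y : set PN) : algebraic_set Y <->
  forall p, (forall F, is_homog F -> Y `<=` zeros F -> vanishes_at F p) -> Y p.
Proof.
split=> [[S hS ->] p h|h].
  by move=> F SF; apply: h => [|q]; [apply: hS|apply].
exists (vanishing_forms Y); first by move=> F [].
apply/seteqP; split=> [p Yp F [_ YF]|p hp]; first exact: YF.
by apply: h => F hF YF; apply: hp.
Qed.

Lemma separating_form (Y A : set PN) : algebraic_set Y -> ~ A `<=` Y ->
  exists F, [/\ is_homog F, Y `<=` zeros F & ~ A `<=` zeros F].
Proof.
move=> /algebraicP hY /existsNP[p /not_implyP[Ap Yp]].
apply: contrapT => hno; apply: Yp; apply: hY => F hF YF.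
apply: contrapT => Fp; apply: hno; exists F; split=> // h; exact/Fp/h.
Qed.

Lemma vanishes_mul d e (F G : poly) p : F \is d.-homog -> G \is e.-homog ->
  vanishes_at (F * G) p <-> vanishes_at F p \/ vanishes_at G p.
Proof.
move=> hF hG; rewrite (vanishes_coords p hF) (vanishes_coords p hG).
rewrite (vanishes_coords p (dhomogM hF hG)) mevalM.
split=> [/eqP|[->|->]]; rewrite ?(mul0r, mulr0) // mulf_eq0.
by case/orP => /eqP ->; [left|right].
Qed.

Lemma is_homogM (F G : poly) : is_homog F -> is_homog G -> is_homog (F * G).
Proof. by move=> [d hF] [e hG]; exists (d + e)%N; apply: dhomogM. Qed.

Lemma algebraicU (Y Z : set PN) :
  algebraic_set Y -> algebraic_set Z -> algebraic_set (Y `|` Z).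
Proof.
move=> hY hZ; apply/algebraicP => p h; apply: contrapT => /not_orP[Yp Zp].
have [|F [[d hF] YF Fp]] := @separating_form Y [set p] hY; first by move/(_ p erefl).
have [|G [[e hG] ZG Gp]] := @separating_form Z [set p] hZ; first by move/(_ p erefl).
have /(vanishes_mul _ hF hG)[] : vanishes_at (F * G) p.
- apply: h => [|q []]; first by apply: is_homogM; [exists d|exists e].
    by move=> /YF ?; apply/(vanishes_mul _ hF hG); left.
  by move=> /ZG ?; apply/(vanishes_mul _ hF hG); right.
- by move=> h'; apply: Fp => _ ->.
- by move=> h'; apply: Gp => _ ->.
Qed.

Lemma algebraic_bigcap (J : Type) (D : set J) (Y : J -> set PN) :
  (forall j, D j -> algebraic_set (Y j)) -> algebraic_set (\bigcap_(j in D) Y j).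
Proof.
move=> h; apply/algebraicP => p hp j Dj; apply: (proj1 (algebraicP _) (h j Dj)) => F hF YF.
by apply: hp => // q /(_ j Dj); apply: YF.
Qed.

Lemma algebraicI (Y Z : set PN) :
  algebraic_set Y -> algebraic_set Z -> algebraic_set (Y `&` Z).
Proof.
move=> hY hZ; rewrite -bigcap2E; apply: algebraic_bigcap => -[|[|i]] _ //=.
by exists set0 => //; rewrite bigcap_set0.
Qed.

Lemma algebraic_bigU (Y : nat -> set PN) k :
  (forall i, (i < k)%N -> algebraic_set (Y i)) ->
  algebraic_set [set p | exists2 i, (i < k)%N & Y i p].
Proof.
elim: k => [|k IH] h.
  (* The empty set is closed because of the degree-zero form 1. *)
  apply/algebraicP => p hp; have h1 : (1 : poly) \is 0.-homog by apply: dhomog1.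
  have /(vanishes_coords p h1) : vanishes_at (1 : poly) p.
    by apply: hp => [|q [//]]; exists 0%N.
  by rewrite meval1 => /eqP; rewrite oner_eq0.
rewrite (_ : [set p | _] = [set p | exists2 i, (i < k)%N & Y i p] `|` Y k).
  by apply: algebraicU; [apply: IH => i ik; apply: h; apply: ltnW|apply: h].
apply/seteqP; split=> [p [i]|p [[i ik Yi]|Yk]].
- by rewrite ltnS leq_eqVlt => /orP[/eqP ->|ik] Yi; [right|left; exists i].
- by exists i => //; apply: ltnW.
- by exists k.
Qed.

Lemma variety_algebraic (V : set PN) : variety V -> algebraic_set V.
Proof. by case. Qed.

Lemma variety_bigU (V : set PN) (Y : nat -> set PN) k : variety V ->
  (forall i, (i < k)%N -> algebraic_set (Y i)) ->
  (forall p, V p -> exists2 i, (i < k)%N & Y i p) ->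
  exists2 i, (i < k)%N & V `<=` Y i.
Proof.
move=> [_ [p0 Vp0] irr]; elim: k => [|k IH] hY hV; first by have [] := hV _ Vp0.
have hU : algebraic_set [set p | exists2 i, (i < k)%N & Y i p].
  by apply: algebraic_bigU => i ik; apply: hY; apply: ltnW.
have [|h|h] := irr _ _ hU (hY k (ltnSn k)).
- move=> p /hV[i]; rewrite ltnS leq_eqVlt => /orP[/eqP ->|ik] Yi; first by right.
  by left; exists i.
- have [i ik Vi] := IH (fun i ik => hY i (ltnW ik)) h.
  by exists i => //; apply: ltnW.
- by exists k.
Qed.

(** For inhomogeneous F and G, restrict to the line over each point: the two one-variable
    polynomials multiply to zero, so all components of F or all those of G vanish there.
    Irreducibility applies to these two closed conditions. *)
Lemma variety_cone_prime (V : set PN) (F G : poly) : variety V ->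
  (forall v, cone V v -> (F * G).@[v] = 0) ->
  (forall v, cone V v -> F.@[v] = 0) \/ (forall v, cone V v -> G.@[v] = 0).
Proof.
move=> [_ _ irr] hFG.
pose Z (F : poly) := \bigcap_d zeros (pihomog mdeg d F).
have hZ (F' : poly) : algebraic_set (Z F').
  by apply: algebraic_bigcap => d _; apply: zeros_algebraic; exists d; apply: pihomogP.
have Z0 (F' : poly) : V `<=` Z F' -> forall v, cone V v -> F'.@[v] = 0.
  move=> h v Cv; rewrite (pihomog_partitionE (leqnn (msize F'))) raddf_sum big1 // => d _ /=.
  by apply: (proj1 (vanish_cone _ (pihomogP _ _ _))) Cv => p /h; apply.
have [|h|h] := irr (Z F) (Z G) (hZ F) (hZ G); [|by left; apply: Z0|by right; apply: Z0].
move=> p Vp; have [q qt qd] := meval_scale_poly F (coords p).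
have [r rt rd] := meval_scale_poly G (coords p).
have : q * r = 0.
  apply: poly_eq0_horner => t; rewrite hornerM qt rt -mevalM; apply: hFG.
  by apply: cone_is_cone; apply: cone_coords.
move/eqP; rewrite mulf_eq0 => /orP[] /eqP e; [left|right] => d _;
  apply/(vanishes_coords _ (pihomogP _ _ _)).
  by rewrite -qd e coef0.
by rewrite -rd e coef0.
Qed.

(** A minimal counterexample is nonempty and reducible, hence covered by two smaller closed sets
    that do decompose. *)
Lemma decomposition (Y : set PN) : algebraic_set Y -> exists k (Z : nat -> set PN),
  (forall i, (i < k)%N -> variety (Z i) /\ Z i `<=` Y) /\
  forall p, Y p -> exists2 i, (i < k)%N & Z i p.
Proof.
move=> hY; apply: contrapT => hno.
pose dec (Y : set PN) := exists k (Z : nat -> set PN),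
  (forall i, (i < k)%N -> variety (Z i) /\ Z i `<=` Y) /\
  forall p, Y p -> exists2 i, (i < k)%N & Z i p.
(* Choose [P i] vanishing on [u i.+1] but not on [u i]. Some [P s] is a combination of its
   predecessors, which all vanish on [u s]. *)
have dcc (u : nat -> set PN) :
    ~ forall i, [/\ algebraic_set (u i.+1), u i.+1 `<=` u i & ~ u i `<=` u i.+1].
  move=> hu; have /choice[P hP] i : exists F, [/\ is_homog F, u i.+1 `<=` zeros F & ~ u i `<=` zeros F].
    by have [h1 h2 h3] := hu i; apply: separating_form.
  have mono i j : (i <= j)%N -> u j `<=` u i.
    move=> /subnK <-; elim: (_ - _)%N => // l IH p /=.
    by have [_ h _] := hu (l + i)%N => /h /IH.
  have [s [c e]] := hilbert_basis P.
  have [[d hd] _ hs] := hP s; apply: hs.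
  apply/(vanish_cone _ hd) => v Cv; rewrite e raddf_sum big1 // => i _ /=.
  have [[d' hd'] h _] := hP i; rewrite mevalM (proj1 (vanish_cone _ hd') h) ?mulr0 //.
  by apply: cone_sub Cv; apply: mono.
pose lt (Z Y : set PN) := [/\ algebraic_set Z, Z `<=` Y & ~ Y `<=` Z].
have [|X [hX nX] Xmin] := @no_descent_minimal _ lt (fun Y => algebraic_set Y /\ ~ dec Y) dcc.
  by exists Y.
have smaller Z : algebraic_set Z -> Z `<=` X -> ~ X `<=` Z -> dec Z.
  move=> hZ ZX XZ; apply: contrapT => nZ; apply: (Xmin Z) => //; split=> //.
apply: nX; case: (pselect (X !=set0)) => [X0|X0]; last first.
  by exists 0%N, (fun=> set0); split=> // p Xp; case: X0; exists p.
case: (pselect (variety X)) => [vX|nvX]; first by exists 1%N, (fun=> X); (split=> [i _|p Xp]; [split|exists 0%N]).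
have [Y1 [Y2 [h1 [h2 [hU [n1 n2]]]]]] : exists Y1 Y2, algebraic_set Y1 /\ algebraic_set Y2 /\
    X `<=` Y1 `|` Y2 /\ ~ X `<=` Y1 /\ ~ X `<=` Y2.
  apply: contrapT => h; apply: nvX; split=> // Y1 Y2 h1 h2 hU.
  by apply: contrapT => /not_orP[n1 n2]; apply: h; exists Y1, Y2.
have dI Y' : algebraic_set Y' -> ~ X `<=` Y' -> dec (X `&` Y').
  move=> h nX; apply: smaller; [exact: algebraicI|by move=> p []|].
  by move=> h'; apply: nX => p /h'[].
have [k1 [Z1 [hZ1 c1]]] := dI Y1 h1 n1; have [k2 [Z2 [hZ2 c2]]] := dI Y2 h2 n2.
exists (k1 + k2)%N, (fun i => if (i < k1)%N then Z1 i else Z2 (i - k1)%N); split.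
  move=> i ik; case: ltnP => lt1.
    by have [v s] := hZ1 i lt1; split=> // p /s[].
  by have [|v s] := hZ2 (i - k1)%N; [lia|split=> // p /s[]].
move=> p Xp; have [Y1p|Y2p] := hU p Xp.
  have [i ik Zi] := c1 p (conj Xp Y1p); exists i; first exact: ltn_addr.
  by rewrite ik.
have [i ik Zi] := c2 p (conj Xp Y2p); exists (k1 + i)%N; first by rewrite ltn_add2l.
by rewrite ltnNge leq_addr addKn.
Qed.

End ProjectiveSets.

(** * Almost integral elements *)

Definition prime_on (K : fieldType) n (C : set ('I_n -> K)) : Prop :=
  forall F G : {mpoly K[n]}, (forall v, C v -> (F * G).@[v] = 0) ->
    (forall v, C v -> F.@[v] = 0) \/ (forall v, C v -> G.@[v] = 0).

Definition comp_family (K : fieldType) n m (H : 'I_m -> {mpoly K[n]}) (b : {mpoly K[m]}) :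
  {mpoly K[n]} := b \mPo [tuple H i | i < m].

Lemma comp_familyE (K : fieldType) n m (H : 'I_m -> {mpoly K[n]}) b v :
  (comp_family H b).@[v] = b.@[values H v].
Proof.
rewrite /comp_family comp_mpoly_meval; apply: meval_eq => i.
by rewrite tnth_mktuple.
Qed.

Lemma values_rcons (K : fieldType) n m (H : 'I_m -> {mpoly K[n]}) F v :
  values (rcons_point H F) v = rcons_point (values H v) F.@[v].
Proof.
by apply/funext => i; rewrite /values /rcons_point; case: unliftP.
Qed.

Lemma mwiden_eval (K : fieldType) n (b : {mpoly K[n]}) v x :
  (mwiden b).@[rcons_point v x] = b.@[v].
Proof. by rewrite -muni_eval muni_mwiden map_polyC hornerC. Qed.

Lemma eval_max (K : fieldType) n (v : 'I_n -> K) x :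
  ('X_ord_max : {mpoly K[n.+1]}).@[rcons_point v x] = x.
Proof. by rewrite mevalXU rcons_point_max. Qed.

(** As [b] is free of the last variable, it multiplies the coefficients in that variable one by one
    and cannot absorb a power of it. *)
Lemma Xmax_dvd (K : fieldType) n (b : {mpoly K[n]}) (p q : {mpoly K[n.+1]}) s :
  b != 0 -> mwiden b * p = 'X_ord_max ^+ s * q -> exists p', p = 'X_ord_max ^+ s * p'.
Proof.
move=> bn /(congr1 (@muni n K)); rewrite !rmorphM rmorphXn /= muni_mwiden muni_Xmax => e.
have take0 : take_poly s (muni p) = 0.
  apply/polyP => i; rewrite coef_take_poly coef0; case: ltnP => [lt|_]; last by [].
  have /eqP : b * (muni p)`_i = 0 by rewrite -coefCM e coefXnM lt.
  by rewrite mulf_eq0 (negPf bn) => /eqP.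
exists (mmulti (drop_poly s (muni p))); apply: muni_inj.
rewrite rmorphM rmorphXn /= muni_Xmax mmultiK mulrC.
by rewrite -{1}(poly_take_drop s (muni p)) take0 add0r.
Qed.

Section AlgIndep.
Context {K : fieldType} {n m : nat} {C : set ('I_n -> K)}.
Hypothesis primeC : prime_on C.

Lemma prime_onX F k : (exists v, C v) ->
  (forall v, C v -> (F ^+ k).@[v] = 0) -> forall v, C v -> F.@[v] = 0.
Proof.
move=> [v0 Cv0]; elim: k => [|k IH] h.
  by have := h _ Cv0; rewrite expr0 meval1 => /eqP; rewrite oner_eq0.
by move: h; rewrite exprS => /primeC[|/IH].
Qed.

(** From a relation, the largest power of the last variable is split off; primality on C cancels
    that power of F. On [C'], where F = 0, the constant term of the remaining factor is a nonzero
    relation between the [G]. *)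
Lemma alg_indep_rcons (C' : set ('I_n -> K)) (G : 'I_m -> {mpoly K[n]}) F :
  C' `<=` C -> (forall v, C' v -> F.@[v] = 0) -> ~ (forall v, C v -> F.@[v] = 0) ->
  alg_indep C' G -> alg_indep C (rcons_point G F).
Proof.
move=> sub F0 /existsNP[v0 /not_implyP[Cv0 Fv0]] indG b hb; apply/eqP/negPn/negP => bn.
have mn : muni b != 0 by rewrite -(rmorph0 (@muni m K)) (inj_eq (@muni_inj _ _)).
have [k [q qn e]] := multiplicity_XsubC (muni b) 0.
move: qn e; rewrite mn /= polyC0 subr0 /root horner_coef0 => qn e.
have bE v : b.@[values (rcons_point G F) v] =
    (comp_family (rcons_point G F) (mmulti q) * F ^+ k).@[v].
  rewrite mevalM comp_familyE values_rcons -!muni_eval mmultiK e.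
  by rewrite rmorphM rmorphXn /= map_polyX hornerM hornerXn rmorphXn.
have hFG v : C v -> (comp_family (rcons_point G F) (mmulti q) * F ^+ k).@[v] = 0.
  by move=> Cv; rewrite -bE; apply: hb.
case: (primeC hFG).
- move=> h; case/negP: qn; apply/eqP; apply: indG => v C'v.
  have := h v (sub v C'v); rewrite comp_familyE values_rcons -muni_eval mmultiK F0 //.
  by rewrite horner_coef0 coef_map.
- by move=> h; apply: Fv0; apply: (prime_onX _ h Cv0); exists v0.
Qed.

End AlgIndep.

Section AlmostIntegral.
Context {K : fieldType} {n : nat} {C : set ('I_n -> K)}.

(** [E] is a maximal set of generators independent over K[H]. Each generator has a nonzero multiple
    in their span, and the product of these multipliers is [d]. *)
Lemma common_denominator m (H : 'I_m -> {mpoly K[n]}) : module_finite C H ->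
  exists (J : finType) (E : {set J}) (e : J -> {mpoly K[n]}) (d : {mpoly K[m]}),
  [/\ d != 0,
    forall p : J -> {mpoly K[m]},
      (forall v, C v -> \sum_(j in E) (p j).@[values H v] * (e j).@[v] = 0) ->
      forall j, j \in E -> p j = 0 &
    forall P, exists p : J -> {mpoly K[m]}, forall v, C v ->
      d.@[values H v] * P.@[v] = \sum_(j in E) (p j).@[values H v] * (e j).@[v]].
Proof.
move=> [J [u hu]].
pose indep (E : {set J}) := `[< forall p : J -> {mpoly K[m]},
  (forall v, C v -> \sum_(j in E) (p j).@[values H v] * (u j).@[v] = 0) ->
  forall j, j \in E -> p j = 0 >].
have i0 : indep finset.set0 by apply/asboolP => p _ j; rewrite inE.
case: (arg_maxnP (fun E : {set J} => #|E|) i0) => E /asboolP indE Emax.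
have /choice[qr hqr] l : exists qr : {mpoly K[m]} * (J -> {mpoly K[m]}), qr.1 != 0 /\
    forall v, C v -> qr.1.@[values H v] * (u l).@[v] =
      \sum_(j in E) (qr.2 j).@[values H v] * (u j).@[v].
  have [lE|lE] := boolP (l \in E).
    exists (1, fun j => (j == l)%:R); split=> [|v Cv]; first exact: oner_neq0.
    rewrite (bigD1 l) //= eqxx big1 ?addr0 // => j /andP[_ ne].
    by rewrite (negPf ne) raddf0 mul0r.
  have : ~ indep (l |: E).
    by move=> /Emax /=; rewrite cardsU1 lE add1n ltnn.
  move=> nind; have /existsNP[p /not_implyP[hp /existsNP[j0 /not_implyP[j0E pj0]]]] := fun h => nind (asboolT h).
  have splitE v : \sum_(j in l |: E) (p j).@[values H v] * (u j).@[v] =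
      (p l).@[values H v] * (u l).@[v] + \sum_(j in E) (p j).@[values H v] * (u j).@[v].
    by rewrite big_setU1.
  exists (p l, fun j => - p j); split=> [|v Cv] /=.
    apply/eqP => pl; apply: pj0; case/finset.setU1P: j0E => [-> //|]; apply: indE => v Cv.
    by have := hp v Cv; rewrite splitE pl meval0 mul0r add0r.
  have := hp v Cv; rewrite splitE => /eqP; rewrite addr_eq0 -sumrN => /eqP ->.
  by apply: eq_bigr => j _; rewrite mevalN mulNr.
exists J, E, u, (\prod_l (qr l).1); split=> //.
  by apply/prodf_neq0 => l _; have [] := hqr l.
move=> P; have [c hc] := hu P.
exists (fun j => \sum_l c l * (\prod_(l' | l' != l) (qr l').1) * (qr l).2 j) => v Cv.
rewrite hc // mulr_sumr.
under [RHS]eq_bigr => j _ do rewrite raddf_sum /= mulr_suml.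
rewrite [RHS]exchange_big /=; apply: eq_bigr => l _.
under [RHS]eq_bigr => j _ do rewrite mevalM -mulrA.
rewrite -mulr_sumr -(proj2 (hqr l)) // (bigD1 l) //= !mevalM; ring.
Qed.

(* With h = a / F0 = c / b(H), some d <> 0 satisfies d h^s \in (+) K[H, F0] e_j for all s, as no
   power of F0 shares a factor with b; by noetherianity h is then integral. *)
Theorem almost_integral_vanish m (H : 'I_m -> {mpoly K[n]}) F0 (b : {mpoly K[m]}) a c :
  prime_on C -> module_finite C (rcons_point H F0) -> alg_indep C (rcons_point H F0) ->
  b != 0 -> (forall v, C v -> a.@[v] * b.@[values H v] = F0.@[v] * c.@[v]) ->
  forall v, C v -> F0.@[v] = 0 -> a.@[v] = 0.
Proof.
move=> primeC finH indH bn hab; set Ha := rcons_point H F0.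
have [J [E [e [d [dn indE hd]]]]] := common_denominator finH.
have valE v : values Ha v = rcons_point (values H v) F0.@[v] by apply: values_rcons.
have /choice[eps heps] s : exists eps, forall v, C v ->
    d.@[values Ha v] * a.@[v] ^+ s = F0.@[v] ^+ s * eps.@[v].
  have [p hp] := hd (a ^+ s); have [q hq] := hd (c ^+ s).
  (* On C, (a b(H))^s = (F0 c)^s; comparing coordinates on the independent [e j] gives b^s p_j = X^s
     q_j, where X stands for [F0] and does not occur in b. *)
  have /choice[p' hp'] j : exists p', j \in E -> p j = 'X_ord_max ^+ s * p'.
    have [jE|] := boolP (j \in E); last by exists 0.
    suff e0 : mwiden (b ^+ s) * p j - 'X_ord_max ^+ s * q j = 0.
      have [|p' pp'] := @Xmax_dvd K m (b ^+ s) (p j) (q j) s (expf_neq0 _ bn).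
        by apply/eqP; rewrite -subr_eq0; apply/eqP.
      by exists p'.
    apply: (indE (fun j => mwiden (b ^+ s) * p j - 'X_ord_max ^+ s * q j) _ j jE) => v Cv.
    under eq_bigr => i _.
      rewrite mevalB !mevalM mulrBl -!mulrA valE mwiden_eval !rmorphXn /= eval_max -valE.
      over.
    rewrite sumrB -!mulr_sumr -hp // -hq // !rmorphXn /= [_ * (_ * a.@[v] ^+ s)]mulrCA.
    by rewrite [_ ^+ s * (_ * c.@[v] ^+ s)]mulrCA -!exprMn [_ * a.@[v]]mulrC hab // subrr.
  exists (\sum_(j in E) comp_family Ha (p' j) * e j) => v Cv.
  have := hp v Cv; rewrite rmorphXn /= => ->; rewrite raddf_sum /= mulr_sumr.
  apply: eq_bigr => j jE; rewrite hp' // !mevalM comp_familyE valE rmorphXn /= eval_max.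
  by rewrite mulrA.
(* Writing [eps s] through earlier terms and multiplying by [F0 ^+ s] gives, up to the factor [d], a
   monic equation for [a] whose lower coefficients are divisible by [F0]. After [d] is cancelled,
   only [a ^+ s] survives where [F0] vanishes. *)
have [s [g hg]] := hilbert_basis eps.
have key v : C v -> (comp_family Ha d * (a ^+ s - \sum_(i < s) g i * F0 ^+ (s - i) * a ^+ i)).@[v] = 0.
  move=> Cv; rewrite mevalM comp_familyE mevalB mulrBr rmorphXn /= heps // hg.
  rewrite !(raddf_sum (meval v)) /= !mulr_sumr -sumrB big1 // => i _.
  rewrite !mevalM !rmorphXn /= [X in _ - X](_ : _ =
    (g i).@[v] * F0.@[v] ^+ (s - i) * (d.@[values Ha v] * a.@[v] ^+ i)); last by ring.
  rewrite heps // -{1}(subnK (ltnW (ltn_ord i))) exprD; ring.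
move=> v Cv F0v; case: (primeC _ _ key) => h.
  by move: dn; rewrite (indH d) ?eqxx // => w Cw; rewrite -comp_familyE; apply: h.
have := h v Cv; rewrite mevalB rmorphXn /= (raddf_sum (meval v)) /= big1 ?subr0.
  by move/eqP; rewrite expf_eq0 => /andP[_ /eqP].
move=> i _; rewrite !mevalM rmorphXn /= F0v expr0n subn_eq0 leqNgt ltn_ord /=.
by rewrite mulr0 mul0r.
Qed.

End AlmostIntegral.

(** * Dimension of varieties *)

Section Dimension.
Context {K : closedFieldType} {N : nat}.
Local Notation PN := (proj_space K N).
Local Notation poly := {mpoly K[N.+1]}.
Implicit Types (Y V W : set PN).

Lemma dim_ge_sub Y Y' d : Y `<=` Y' -> dim_ge Y d -> dim_ge Y' d.
Proof.
move=> YY' [Z [hZ1 hZ2]]; exists Z; split=> // i /hZ1[v s]; split=> //.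
exact: subset_trans YY'.
Qed.

Lemma dim_ge_le Y d d' : (d' <= d)%N -> dim_ge Y d -> dim_ge Y d'.
Proof.
by move=> le [Z [h1 h2]]; exists Z; split=> i id; [apply: h1|apply: h2]; apply: leq_trans le.
Qed.

Lemma chain_dim_ge (Z : nat -> set PN) d : (forall i, (i <= d)%N -> variety (Z i)) ->
  (forall i, (i < d)%N -> Z i `<` Z i.+1) -> dim_ge (Z d) d.
Proof.
move=> h1 h2; exists Z; split=> // i id; split; first exact: h1.
have mono j : (j <= d)%N -> Z (d - j)%N `<=` Z d.
  elim: j => [|j IH] jd; first by rewrite subn0.
  apply: subset_trans (IH (ltnW jd)); have [|h _] := h2 (d - j.+1)%N; first by lia.
  by move: h; rewrite -subSn // subSS.
by rewrite -(subKn id); apply: mono; apply: leq_subr.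
Qed.

Lemma dim_ge_variety Y d : dim_ge Y d -> exists W, [/\ variety W, W `<=` Y & dim_ge W d].
Proof.
move=> [Z [h1 h2]]; exists (Z d); have [v s] := h1 d (leqnn d); split=> //.
by apply: chain_dim_ge => // i /h1[].
Qed.

Lemma dim_ge_extend W V d : variety V -> W `<=` V -> ~ V `<=` W ->
  dim_ge W d -> dim_ge V d.+1.
Proof.
move=> vV WV VW [Z [h1 h2]]; exists (fun i => if (i <= d)%N then Z i else V); split=> i id.
  case: leqP => [le|_]; last by split.
  by have [v s] := h1 i le; split=> //; apply: subset_trans WV.
have -> : (i <= d)%N by [].
case: ltnP => [lt|ge]; first exact: h2.
have <- : d = i by apply/eqP; rewrite eqn_leq ge -ltnS id.
have [v s] := h1 d (leqnn d); split; first exact: subset_trans WV.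
by move=> h; apply: VW; apply: subset_trans h _.
Qed.

Lemma dim_ge_step V d : dim_ge V d.+1 -> exists W V',
  [/\ variety W /\ variety V', V' `<=` V, W `<=` V', ~ V' `<=` W & dim_ge W d].
Proof.
move=> [Z [h1 h2]]; have [vV VV] := h1 d.+1 (leqnn _); have [vW WV] := h1 d (leqnSn _).
have [s ns] := h2 d (ltnSn _); exists (Z d), (Z d.+1); split=> //.
by apply: chain_dim_ge => i id; [case: (h1 i (leqW id))|apply/h2/ltnW].
Qed.

Lemma point_variety (p : PN) : variety [set p].
Proof.
split; [|by exists p|].
- apply/algebraicP => q h; pose c := coords p; have [i ci] := coords_neq0 p.
  (* A point is cut out by the 2 x 2 minors against its coordinates, which are linear forms. *)
  have cross j l : coords q j * c l = coords q l * c j.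
    have hF : ((c l *: 'X_j - c j *: 'X_l) : poly) \is 1.-homog.
      by rewrite rpredB // dhomogZ // dhomogX /= mdeg1.
    have /(vanishes_coords _ hF) : vanishes_at (c l *: 'X_j - c j *: 'X_l : poly) q.
      apply: h => [|_ ->]; first by exists 1%N.
      by apply/(vanishes_coords _ hF); rewrite mevalB !mevalZ !mevalXU mulrC subrr.
    by rewrite mevalB !mevalZ !mevalXU => /eqP; rewrite subr_eq0 mulrC [c j * _]mulrC => /eqP.
  have e : coords q = (fun j => (coords q i / c i) * c j).
    apply/funext => j; rewrite mulrAC; apply: (mulIf ci).
    by rewrite divfK // cross.
  have qp : vpick (val q) \in val p.
    have -> : vpick (val q) = (coords q i / c i) *: vpick (val p).
      by apply/rowP => j; rewrite mxE; exact: (congr1 (fun f => f j) e).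
    by apply: memvZ; apply: memv_pick.
  apply: val_inj; apply/eqP; rewrite eqEdim !dim_point leqnn andbT.
  suff -> : val q = <[vpick (val q)]>%VS by rewrite -memvE.
  apply/eqP; rewrite eq_sym eqEdim -memvE memv_pick dim_vline dim_point vpick0.
  by rewrite -dimv_eq0 dim_point.
- move=> Y1 Y2 _ _ /(_ p erefl)[]; [left|right] => _ ->; exact.
Qed.

Lemma dim_ge0 Y p : Y p -> dim_ge Y 0.
Proof.
move=> Yp; exists (fun=> [set p]); split=> // i _; split; first exact: point_variety.
by move=> _ ->.
Qed.

Lemma dim0_point V : variety V -> ~ dim_ge V 1 -> exists p, V = [set p].
Proof.
move=> vV nd; have [_ [p Vp] _] := vV; exists p; apply/seteqP; split; last by move=> _ ->.
apply: contrapT => nVp; apply: nd; apply: (@dim_ge_extend [set p]) => //; first by move=> _ ->.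
exact: (@dim_ge0 [set p] p).
Qed.

Definition pos_form (F : poly) := exists2 d, (0 < d)%N & F \is d.-homog.

Lemma pos_form_homog F : pos_form F -> is_homog F.
Proof. by move=> [d _ hd]; exists d. Qed.

Lemma pos_form0 F : pos_form F -> F.@[fun=> 0] = 0.
Proof.
move=> [d d0 hd]; have := meval_scale 0 (fun=> 0) hd.
rewrite expr0n eqn0Ngt d0 [RHS]mul0r => e; rewrite -[RHS]e.
by apply: meval_eq => i; rewrite mul0r.
Qed.

(** The forms with coefficients 1, t, t^2, ... suffice: at each point such a form is a nonzero
    polynomial in t, and the product of these has a non-root. *)
Lemma linear_form_avoiding (p : nat -> PN) k :
  exists2 L : poly, L \is 1.-homog & forall i, (i < k)%N -> ~ vanishes_at L (p i).
Proof.
pose q i : {poly K} := \poly_(j < N.+1) coords (p i) (inord j).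
have qE i j : (q i)`_(j : 'I_N.+1) = coords (p i) j by rewrite coef_poly ltn_ord inord_val.
have : \prod_(i < k) q i != 0.
  apply/prodf_neq0 => i _; have [j cj] := coords_neq0 (p i).
  by apply: contraNneq cj => e; rewrite -qE e coef0.
move/closed_nonroot => [t]; rewrite horner_prod => /prodf_neq0 ht.
have hL : (\sum_(j < N.+1) t ^+ j *: 'X_j : poly) \is 1.-homog.
  by apply: rpred_sum => j _; apply: dhomogZ; rewrite dhomogX /= mdeg1.
exists (\sum_(j < N.+1) t ^+ j *: 'X_j) => // i ik /(vanishes_coords _ hL).
have := ht (Ordinal ik) isT; rewrite horner_poly /= raddf_sum /= => /negP h e; apply: h.
apply/eqP; rewrite -[RHS]e; apply: eq_bigr => j _; by rewrite mevalZ mevalXU mulrC inord_val.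
Qed.

Definition cuts Y k (H : 'I_k -> poly) : Prop :=
  (forall j, pos_form (H j)) /\ forall p, Y p -> exists j, ~ vanishes_at (H j) p.

Lemma cuts_rcons Y k (H : 'I_k -> poly) F : pos_form F ->
  cuts (Y `&` zeros F) H -> cuts Y (rcons_point H F).
Proof.
move=> hF [h1 h2]; split=> [j|p Yp].
  by rewrite /rcons_point; case: unliftP.
case: (pselect (vanishes_at F p)) => [Fp|Fp]; last by exists ord_max; rewrite rcons_point_max.
have [//|j hj] := h2 p; exists (widen_ord (leqnSn k) j).
by rewrite rcons_point_widen.
Qed.

(** A linear form nonzero at one point of each piece of a decomposition lowers the dimension. The
    hypothesis says dim Y < k, and k = 0 means that Y is empty. *)
Lemma cutting_forms Y k : algebraic_set Y -> ~ dim_ge Y k -> exists H : 'I_k -> poly, cuts Y H.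
Proof.
elim: k Y => [|k IH] Y hY nd.
  by exists (fun=> 0); split=> [[]//|p /dim_ge0].
have [s [Z [hZ1 hZ2]]] := decomposition hY.
have /choice[p hp] i : exists p, (i < s)%N -> Z i p.
  case: (ltnP i s) => [lt|ge].
    by have [[_ [p Zp] _] _] := hZ1 i lt; exists p.
  have [p0 _] : exists p : PN, True.
    by have [|p _] := @point_of K N (fun=> 1); [exists ord0; apply: oner_neq0|exists p].
  by exists p0.
have [L hL Lp] := linear_form_avoiding p s.
have [|nd'|H hH] := IH (Y `&` zeros L).
- by apply: algebraicI => //; apply: zeros_algebraic; exists 1%N.
- apply: nd; have [W [vW WY dW]] := dim_ge_variety nd'.
  have [|q Wq|i is_ WZ] := variety_bigU vW (Y := Z) (k := s).
  + by move=> i /hZ1[/variety_algebraic].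
  + by apply: hZ2; have [] := WY q Wq.
  have [vZ ZY] := hZ1 i is_; apply: dim_ge_sub ZY _; apply: dim_ge_extend dW => //.
  by move=> h; apply: (Lp i is_); have [] := WY _ (h _ (hp i is_)).
by exists (rcons_point H L); apply: cuts_rcons => //; exists 1%N.
Qed.

(** The ideal generated by I(Y) and the [H j] has at most the origin as affine zero, so the
    Nullstellensatz puts a power of every coordinate into it. *)
Lemma cut_module_finite Y k (H : 'I_k -> poly) : algebraic_set Y -> cuts Y H ->
  module_finite (cone Y) H.
Proof.
move=> hY [hH hcut]; have /choice[e he] j : exists d, (0 < d)%N /\ H j \is d.-homog.
  by have [d] := hH j; exists d.
pose I (P : poly) := exists c : 'I_k -> poly, forall v, cone Y v ->
  P.@[v] = \sum_j (c j).@[v] * (H j).@[v].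
have hI : ideal_pred I.
  split.
  - by exists (fun=> 0) => v _; rewrite meval0 big1 // => j _; rewrite ?meval0 mul0r.
  - move=> p q [c hc] [d hd]; exists (fun j => c j + d j) => v Cv.
    rewrite mevalD hc // hd // -big_split; apply: eq_bigr => j _ /=.
    by rewrite mevalD mulrDl.
  - move=> p q [c hc]; exists (fun j => p * c j) => v Cv.
    by rewrite mevalM hc // mulr_sumr; apply: eq_bigr => j _; rewrite mevalM mulrA.
have /choice[D hD] i : exists d, I ('X_i ^+ d).
  apply: nullstellensatz => // v hv; rewrite mevalXU; apply/eqP/negPn/negP => vi.
  have [|p [t t0 pt]] := @point_of K N v; first by exists i.
  have Yp : Y p.
    apply: (proj1 (algebraicP _) hY) => F [d hF] YF; apply/(vanishes_coords _ hF).
    rewrite pt (meval_scale _ _ hF) hv ?mulr0 //; exists (fun=> 0) => w Cw.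
    rewrite (proj1 (vanish_cone Y hF) YF) // big1 // => j _; by rewrite ?meval0 mul0r.
  have [j hj] := hcut p Yp; apply: hj; have [_ hd] := he j; apply/(vanishes_coords _ hd).
  rewrite pt (meval_scale _ _ hd) hv ?mulr0 //; exists (fun l => (l == j)%:R) => w Cw.
  rewrite (bigD1 j) //= eqxx meval1 mul1r big1 ?addr0 // => l ne.
  by rewrite (negPf ne) meval0 mul0r.
(* The sum is an exponent that serves all coordinates. *)
apply: (@module_finite_of_power _ _ _ _ H e (\sum_i D i)%N).
- exact: cone_is_cone.
- by move=> j; have [] := he j.
- by move=> j; have [] := he j.
move=> i; have [c hc] : I ('X_i ^+ (\sum_i D i)%N).
  by rewrite (bigD1 i) //= addnC exprD; apply: idealMl.
by exists c => v Cv; rewrite -hc // rmorphXn /= mevalXU.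
Qed.

Lemma variety_prime_on V : variety V -> prime_on (cone V).
Proof. by move=> vV F G; apply: variety_cone_prime. Qed.

(** The bottom of every chain of cones: at a single point, no forms are independent because
    relations are constants. *)
Lemma alg_indep_origin (H : 'I_0 -> poly) : alg_indep [set (fun=> 0) : 'I_N.+1 -> K] H.
Proof.
move=> b hb; rewrite -(mpolyKC b); have := hb _ erefl.
by rewrite -{1}(mpolyKC b) mevalC => ->; rewrite mpolyC0.
Qed.

Lemma origin_cone V : variety V -> [set (fun=> 0) : 'I_N.+1 -> K] `<=` cone V.
Proof.
move=> [_ [p Vp] _] _ ->; exists p => //; exists 0; apply/funext => i; by rewrite mul0r.
Qed.

Lemma chain_alg_indep V d : variety V -> dim_ge V d ->
  exists G : 'I_d.+1 -> poly, alg_indep (cone V) G.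
Proof.
elim: d V => [|d IH] V vV dV.
  have [_ [p Vp] _] := vV; have [i ci] := coords_neq0 p.
  exists (rcons_point (fun=> 0) 'X_i).
  apply: (alg_indep_rcons (variety_prime_on vV) (origin_cone vV)) => [_ ->||].
  - by rewrite mevalXU.
  - by move=> /(_ _ (cone_coords Vp)) /eqP; rewrite mevalXU (negPf ci).
  - exact: alg_indep_origin.
have [W [V' [[vW vV'] V'V WV' nW dW]]] := dim_ge_step dV.
have [G hG] := IH W vW dW.
have [F [[e hF] WF VF]] := separating_form (variety_algebraic vW) nW.
exists (rcons_point G F).
apply: (alg_indep_rcons (variety_prime_on vV) (cone_sub (subset_trans WV' V'V))) hG.
- exact: (proj1 (vanish_cone _ hF) WF).
- by move=> h; apply: VF; apply/(vanish_cone _ hF) => v Cv; apply: h; apply: cone_sub Cv.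
Qed.

Lemma dim_cuts_bound V d k (H : 'I_k -> poly) : variety V -> dim_ge V d -> cuts V H -> (d < k)%N.
Proof.
move=> vV dV cH; have [G hG] := chain_alg_indep vV dV.
exact: module_finite_bound (cut_module_finite (variety_algebraic vV) cH) hG.
Qed.

(** A section of smaller dimension would be cut by d forms; adding F, d + 1 forms would have no
    common zero on V, against [dim_cuts_bound]. *)
Lemma dim_hypersurface_section V d F : variety V -> pos_form F -> dim_ge V d.+1 ->
  dim_ge (V `&` zeros F) d.
Proof.
move=> vV hF dV; apply: contrapT => nd.
have [|H hH] := cutting_forms _ nd.
  by apply: algebraicI; [apply: variety_algebraic|apply/zeros_algebraic/pos_form_homog].
by have := dim_cuts_bound vV dV (cuts_rcons hF hH); rewrite ltnn.
Qed.

Lemma rcons_point_eta T k (H : 'I_k.+1 -> T) :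
  H = rcons_point (fun j => H (widen_ord (leqnSn k) j)) (H ord_max).
Proof.
apply/funext => i; rewrite /rcons_point; case: unliftP => [j|] ->//.
by rewrite widen_lift_max.
Qed.

(** Cutting by the last form leaves a variety of dimension at least d - 1 on which the others still
    have no common zero; [alg_indep_rcons] then adds the last form. *)
Lemma cut_alg_indep V d (H : 'I_d.+1 -> poly) : variety V -> dim_ge V d -> cuts V H ->
  alg_indep (cone V) H.
Proof.
elim: d V H => [|d IH] V H vV dV cH; rewrite (rcons_point_eta H);
  have [hH hcut] := cH; have primeV := variety_prime_on vV.
  apply: (alg_indep_rcons primeV (origin_cone vV)) => [_ ->|h|].
  - exact: pos_form0.
  - have [_ [p Vp] _] := vV; have [j] := hcut p Vp; apply.
    have [e _ he] := hH j; apply/(vanishes_coords _ he).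
    by rewrite (_ : j = ord_max) ?h //; [apply: cone_coords|rewrite [j]ord1 [ord_max]ord1].
  - exact: alg_indep_origin.
set H' := fun j => _; set F := H ord_max; have hF : pos_form F by apply: hH.
have cH' : cuts (V `&` zeros F) H'.
  split=> [j|p [Vp Fp]]; first exact: hH.
  have [j hj] := hcut p Vp; case: (unliftP ord_max j) hj => [l|] ->; last by move/(_ Fp).
  by rewrite -widen_lift_max; exists l.
have [W [vW WV dW]] := dim_ge_variety (dim_hypersurface_section vV hF dV).
have sub (A : set PN) : A `<=` V `&` zeros F -> cuts A H'.
  by move=> AV; split=> [j|p /AV]; [apply: hH|apply: (proj2 cH')].
have [e _ he] := hF.
apply: (alg_indep_rcons primeV (C' := cone W)).
- by apply: cone_sub => p /WV[].
- by apply/(vanish_cone _ he) => p /WV[].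
(* If the last form vanished on V, the other d + 1 would already cut V, which has dimension at least
   d + 1. *)
- move/(vanish_cone V he) => VF.
  have VFs : V `<=` V `&` zeros F by move=> p Vp; split; [|apply: VF].
  by have := dim_cuts_bound vV dV (sub V VFs); rewrite ltnn.
- by apply: IH => //; apply: sub.
Qed.

(** A product of separating forms, nonzero on W because W is irreducible. Starting from a linear
    form makes its degree positive, so that it also vanishes at the origin. *)
Lemma form_separating_family (Z : nat -> set PN) k W : variety W ->
  (forall i, (i < k)%N -> algebraic_set (Z i)) ->
  exists a, [/\ pos_form a, forall i, (i < k)%N -> ~ W `<=` Z i -> Z i `<=` zeros a &
    ~ W `<=` zeros a].
Proof.
move=> vW; elim: k => [|k IH] hZ.
  have [_ [p Wp] _] := vW; have [L hL Lp] := linear_form_avoiding (fun=> p) 1.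
  exists L; split=> //; first by exists 1%N.
  by move=> h; apply: (Lp 0%N) => //; apply: h.
have [a [ha aZ aW]] := IH (fun i ik => hZ i (ltnW ik)).
case: (pselect (W `<=` Z k)) => [Wk|Wk].
  exists a; split=> // i; rewrite ltnS leq_eqVlt => /orP[/eqP ->//|]; exact: aZ.
have [G [[e hG] ZG WG]] := separating_form (hZ k (ltnSn k)) Wk.
have [d d0 hd] := ha; exists (a * G); split.
- by exists (d + e)%N; [rewrite addn_gt0 d0|apply: dhomogM].
- move=> i; rewrite ltnS leq_eqVlt => /orP[/eqP -> _|ik nW] p Zp; apply/(vanishes_mul _ hd hG).
    by right; apply: ZG.
  by left; apply: (aZ i).
- move/(vanish_cone _ (dhomogM hd hG)) => /(variety_cone_prime vW)[]h.
    by apply: aW; apply/(vanish_cone _ hd).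
  by apply: WG; apply/(vanish_cone _ hG).
Qed.

Lemma homog0_const (F : poly) v w : F \is 0.-homog -> F.@[v] = F.@[w].
Proof.
move=> hF; have h0 u : F.@[u] = F.@[fun=> 0].
  have := meval_scale 0 u hF; rewrite expr0 mul1r => <-.
  by apply: meval_eq => i; rewrite mul0r.
by rewrite h0 [RHS]h0.
Qed.

(* V' is a component of the section of V by a form F vanishing on Z. The components containing Z form
   Y'; if Y' had dimension < m, some b(H) would vanish on Y' and some form a on the others but not
   on Z, so that (a b(H))^k would be a multiple of F on V. *)
Theorem intermediate_variety V Z m : variety V -> variety Z -> Z `<=` V -> ~ V `<=` Z ->
  dim_ge V m.+1 -> ~ dim_ge V m.+2 ->
  exists V', [/\ variety V', Z `<=` V', V' `<=` V, ~ V `<=` V' & dim_ge V' m].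
Proof.
move=> vV vZ ZV nVZ dV ndV.
have [F [[d hF] ZF VF]] := separating_form (variety_algebraic vZ) nVZ.
have d0 : (0 < d)%N.
  rewrite lt0n; apply/eqP => d0; rewrite d0 in hF; have [_ [p Zp] _] := vZ.
  apply: VF => q _; apply/(vanishes_coords _ hF).
  rewrite (homog0_const _ (coords p) hF); apply/(vanishes_coords _ hF); exact: ZF.
have pF : pos_form F by exists d.
have aY : algebraic_set (V `&` zeros F).
  by apply: algebraicI; [apply: variety_algebraic|apply/zeros_algebraic/pos_form_homog].
have nVF W : W `<=` V `&` zeros F -> ~ V `<=` W.
  by move=> h h'; apply: VF => p /h' /h[].
have ndY : ~ dim_ge (V `&` zeros F) m.+1.
  move=> /dim_ge_variety[W [vW WY dW]]; apply: ndV; apply: (dim_ge_extend vV _ (nVF W WY)) dW.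
  by move=> p /WY[].
(* There are m + 1 forms here; with F they are m + 2 = dim V + 1 forms, the number for which the
   ring is finite over them and they are independent. *)
have [H cH] := cutting_forms aY ndY.
have cHF := cuts_rcons pF cH.
have finV := cut_module_finite (variety_algebraic vV) cHF.
have indV := cut_alg_indep vV dV cHF.
have [s [C [hC1 hC2]]] := decomposition aY.
pose C' i := if `[< Z `<=` C i >] then C i else set0.
have aC' i : (i < s)%N -> algebraic_set (C' i).
  move=> /hC1[vC _]; rewrite /C'; case: ifP => _; first exact: variety_algebraic.
  rewrite (_ : set0 = [set p | exists2 i, (i < 0)%N & (fun=> set0 : set PN) i p]).
    exact: algebraic_bigU.
  by apply/seteqP; split=> // p [].
pose Y' := [set p | exists2 i, (i < s)%N & C' i p].
have aY' : algebraic_set Y' by apply: algebraic_bigU.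
case: (pselect (dim_ge Y' m)) => [/dim_ge_variety[W [vW WY' dW]]|nd].
  have [i is_ WC] := variety_bigU vW aC' WY'; have [_ [p Wp] _] := vW.
  have [vC CY] := hC1 i is_; move: WC (WC p Wp); rewrite /C'; case: asboolP => // ZC WC _.
  exists (C i); split=> //; [by move=> q /CY[]|exact: nVF|exact: dim_ge_sub WC dW].
(* Finiteness over these m forms makes the m + 1 forms [H] dependent on the cone over [Y']; [b] is
   such a relation. *)
have [L cL] := cutting_forms aY' nd.
have /existsNP[b /not_implyP[hb /eqP bn]] : ~ alg_indep (cone Y') H.
  by move=> /(module_finite_bound (cut_module_finite aY' cL)); rewrite ltnn.
have [a [ha aC aZ]] := form_separating_family vZ (fun i is_ => variety_algebraic (proj1 (hC1 i is_))).
(* The ideal I(V) + (F). At its zeros [a * comp_family H b] vanishes: through [b] on components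
   containing Z, through [a] on the others and at the origin. *)
pose I (P : poly) := exists c : poly, forall v, cone V v -> P.@[v] = F.@[v] * c.@[v].
have hI : ideal_pred I.
  split.
  - by exists 0 => v _; rewrite !meval0 mulr0.
  - by move=> p q [c hc] [c' hc']; exists (c + c') => v Cv; rewrite !mevalD hc // hc' // mulrDr.
  - by move=> p q [c hc]; exists (p * c) => v Cv; rewrite !mevalM hc // mulrCA.
have [v hv|k [c hc]] := nullstellensatz (F := a * comp_family H b) hI.
  rewrite mevalM comp_familyE; have [v0|/existsNP[i /eqP vi]] := pselect (forall i, v i = 0).
    by rewrite (_ : v = fun=> 0) ?pos_form0 ?mul0r //; apply/funext.
  have [|p [t t0 pt]] := @point_of K N v; first by exists i.
  have ptV (u : set PN) : u p -> cone u v.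
    move=> up; exists p => //; exists t^-1; apply/funext => j.
    by rewrite pt mulrA mulVf // mul1r.
  have Vp : V p.
    apply: (proj1 (algebraicP _) (variety_algebraic vV)) => G [e hG] VG.
    apply/(vanishes_coords _ hG); rewrite pt (meval_scale _ _ hG) hv ?mulr0 //.
    by exists 0 => w Cw; rewrite (proj1 (vanish_cone V hG) VG) // meval0 mulr0.
  have Fp : vanishes_at F p.
    apply/(vanishes_coords _ hF); rewrite pt (meval_scale _ _ hF) hv ?mulr0 //.
    by exists 1 => w Cw; rewrite meval1 mulr1.
  have [j js Cj] := hC2 p (conj Vp Fp); case: (pselect (Z `<=` C j)) => ZC.
    rewrite hb ?mulr0 //; apply: ptV; exists j => //.
    by rewrite /C'; case: asboolP.
  have [e _ he] := ha; rewrite (proj1 (vanish_cone _ he) (aC j js ZC)) ?mul0r //; exact: ptV.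
case: aZ => p Zp; have [e _ he] := ha; apply/(vanishes_coords _ he).
have key : forall v, cone V v -> F.@[v] = 0 -> (a ^+ k).@[v] = 0.
  apply: (almost_integral_vanish (c := c) (variety_prime_on vV) finV indV (expf_neq0 k bn)) => v Cv.
  rewrite -hc // exprMn mevalM !rmorphXn /=; congr (_ * _); by rewrite comp_familyE.
have hFp : F.@[coords p] = 0 by apply/(vanishes_coords _ hF)/ZF.
have := key _ (cone_coords (ZV p Zp)) hFp.
by rewrite rmorphXn /= => /eqP; rewrite expf_eq0 => /andP[_ /eqP].
Qed.

End Dimension.

(** * Zeros of entire functions *)

Section NonArchimedean.
Context {R : realType} {K : closedFieldType} {abs : K -> R}.
Hypothesis habs : nonarch_absval abs.

Let abs_ge0 x : 0 <= abs x. Proof. exact: absval_ge0 habs x. Qed.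
Let absM x y : abs (x * y) = abs x * abs y. Proof. exact: absvalM habs x y. Qed.

Lemma abs0 : abs 0 = 0.
Proof. exact/(absval_eq0 habs). Qed.

Lemma abs_eq0 x : (abs x == 0) = (x == 0).
Proof. by apply/eqP/eqP => /(absval_eq0 habs). Qed.

Lemma abs_gt0 x : (0 < abs x) = (x != 0).
Proof. by rewrite lt0r abs_ge0 andbT abs_eq0. Qed.

Lemma abs1 : abs 1 = 1.
Proof.
have n1 : abs 1 != 0 by rewrite abs_eq0 oner_neq0.
by apply: (mulfI n1); rewrite -absM !mulr1.
Qed.

Lemma absX x k : abs (x ^+ k) = abs x ^+ k.
Proof. by elim: k => [|k IH]; rewrite ?expr0 ?abs1 // !exprS absM IH. Qed.

Lemma absN x : abs (- x) = abs x.
Proof.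
have h : abs (-1) ^+ 2 = 1 ^+ 2 by rewrite -absX sqrrN !expr1n abs1.
have e : abs (-1) = 1 by apply/eqP; rewrite -(eqrXn2 (n := 2)) ?ler01 // h.
by rewrite -mulN1r absM e mul1r.
Qed.

Lemma absD_le x y e : abs x <= e -> abs y <= e -> abs (x + y) <= e.
Proof. by move=> hx hy; apply: le_trans (absvalD_max habs _ _) _; rewrite ge_max hx. Qed.

Lemma absD_lt x y e : abs x < e -> abs y < e -> abs (x + y) < e.
Proof. by move=> hx hy; apply: le_lt_trans (absvalD_max habs _ _) _; rewrite gt_max hx. Qed.

Lemma abs_sum_le (I : Type) (r : seq I) (P : pred I) (F : I -> K) e : 0 <= e ->
  (forall i, P i -> abs (F i) <= e) -> abs (\sum_(i <- r | P i) F i) <= e.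
Proof.
by move=> e0 h; elim/big_rec: _ => [|i x Pi hx]; [rewrite abs0|apply: absD_le => //; apply: h].
Qed.

Lemma abs_sum_lt (I : Type) (r : seq I) (P : pred I) (F : I -> K) e : 0 < e ->
  (forall i, P i -> abs (F i) < e) -> abs (\sum_(i <- r | P i) F i) < e.
Proof.
by move=> e0 h; elim/big_rec: _ => [|i x Pi hx]; [rewrite abs0|apply: absD_lt => //; apply: h].
Qed.

Lemma abs_mulrn_le x n : abs (x *+ n) <= abs x.
Proof.
by elim: n => [|n IH]; [rewrite mulr0n abs0|rewrite mulrS; apply: absD_le].
Qed.

Lemma abs_dominant x y : abs x < abs y -> abs (y + x) = abs y.
Proof.
move=> lt; apply/eqP; rewrite eq_le absD_le ?(ltW lt) //=.
rewrite leNgt; apply/negP => h.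
have : abs (y + x - x) < abs y by apply: absD_lt; rewrite ?absN.
by rewrite addrK ltxx.
Qed.

Lemma abs_small0 x : (forall e, 0 < e -> abs x < e) -> x = 0.
Proof.
move=> h; apply/eqP; rewrite -abs_eq0 eq_le abs_ge0 andbT leNgt; apply/negP => gt.
by have := h _ gt; rewrite ltxx.
Qed.

(** The part of the Newton polygon that is needed: roots outside the closed disc of radius [rho]
    make the constant term strictly dominant there. Each factor 'X - z preserves this, as [z]
    outweighs 'X. *)
Lemma prod_XsubC_dominant (s : seq K) (rho : R) : 0 < rho -> (forall z, z \in s -> rho < abs z) ->
  forall k, (0 < k)%N ->
    abs (\prod_(z <- s) ('X - z%:P))`_k * rho ^+ k < abs (\prod_(z <- s) ('X - z%:P))`_0.
Proof.
move=> r0; elim: s => [|z s IH] hs k k0.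
  by rewrite big_nil !coef1 eqn0Ngt k0 abs0 mul0r abs1.
have zr : rho < abs z by apply: hs; rewrite inE eqxx.
have z0 : 0 < abs z by apply: lt_trans zr.
rewrite big_cons; set p := \prod_(z <- s) _.
have lt_p l : (0 < l)%N -> abs p`_l * rho ^+ l < abs p`_0.
  by apply: IH => y ys; apply: hs; rewrite inE ys orbT.
have p0 : 0 < abs p`_0 by apply: le_lt_trans (lt_p 1%N isT); rewrite mulr_ge0 ?exprn_ge0 // ltW.
rewrite !mulrBl !coefB !coefXM !coefCM eqxx eqn0Ngt k0 /= sub0r absN absM.
have h1 : abs p`_k.-1 * rho ^+ k < abs z * abs p`_0.
  rewrite -[k in X in X < _]prednK // exprSr mulrA.
  apply: (@le_lt_trans _ _ (abs p`_0 * rho)); last by rewrite mulrC ltr_pM2r.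
  rewrite ler_pM2r //; case: (k.-1) => [|l]; first by rewrite expr0 mulr1.
  exact/ltW/lt_p.
have h2 : abs (z * p`_k) * rho ^+ k < abs z * abs p`_0.
  by rewrite absM -mulrA ltr_pM2l // lt_p.
apply: le_lt_trans (_ : Num.max (abs p`_k.-1) (abs (z * p`_k)) * rho ^+ k < _).
  rewrite ler_wpM2r ?exprn_ge0 ?(ltW r0) //.
  by apply: le_trans (absvalD_max habs _ _) _; rewrite absN.
by rewrite /Num.max; case: ifP.
Qed.

Lemma small_root (p : {poly K}) J (rho : R) : 0 < rho -> (0 < J)%N -> p`_J != 0 ->
  abs p`_0 <= abs p`_J * rho ^+ J -> exists2 w, p.[w] = 0 & abs w <= rho.
Proof.
move=> r0 J0 pJ le; apply: contrapT => hno.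
have [s ps] := closed_field_poly_normal p.
have lc0 : lead_coef p != 0 by rewrite lead_coef_eq0; apply: contraNneq pJ => ->; rewrite coef0.
have hs z : z \in s -> rho < abs z.
  move=> zs; rewrite ltNge; apply/negP => zr; apply: hno; exists z => //.
  apply/eqP; rewrite -rootE ps rootZ // root_prod_XsubC //.
have := prod_XsubC_dominant r0 hs J0.
rewrite -(ltr_pM2l (x := abs (lead_coef p))) ?abs_gt0 // mulrA -!absM -!coefZ -ps.
by rewrite ltNge le.
Qed.

Definition entire_coefs (a : nat -> K) (g : K -> K) :=
  forall z, abs_cvg abs (fun m => \sum_(k < m) a k * z ^+ k) (g z).

Lemma abs_cvg_unique u l l' : abs_cvg abs u l -> abs_cvg abs u l' -> l = l'.
Proof.
move=> h h'; apply/eqP; rewrite -subr_eq0; apply/eqP/abs_small0 => e e0.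
have [m hm] := h e e0; have [m' hm'] := h' e e0; set k := maxn m m'.
have -> : l - l' = (u k - l') - (u k - l) by ring.
apply: absD_lt; first by apply: hm'; rewrite leq_maxr.
by rewrite absN; apply: hm; rewrite leq_maxl.
Qed.

Lemma exp_unbounded (x r : R) : 1 < x -> exists n, r < x ^+ n.
Proof.
move=> x1; pose y := x - 1; have y0 : 0 < y by rewrite subr_gt0.
have xE : x = 1 + y by rewrite /y addrC subrK.
have bern n : 1 + n%:R * y <= x ^+ n.
  elim: n => [|n IH]; first by rewrite mul0r addr0.
  rewrite exprS; apply: le_trans (ler_wpM2l _ IH); last by rewrite ltW // (lt_trans ltr01).
  by rewrite xE -natr1; have := ler0n R n; nra.
exists (Num.bound (`|r| / y)); apply: lt_le_trans (bern _).
have := archi_boundP (_ : 0 <= `|r| / y); rewrite divr_ge0 ?normr_ge0 ?(ltW y0) // => /(_ isT).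
rewrite ltr_pdivrMr // => h; apply: le_lt_trans (ler_norm r) _.
by apply: lt_trans h _; rewrite ltrDr ltr01.
Qed.

Section Coefs.
Context {a : nat -> K} {g : K -> K}.
Hypothesis hg : entire_coefs a g.

Lemma terms_null z e : 0 < e -> exists m, forall k, (m <= k)%N -> abs (a k * z ^+ k) < e.
Proof.
move=> e0; have [m hm] := hg z e0; exists m => k mk.
have -> : a k * z ^+ k = (\sum_(i < k.+1) a i * z ^+ i - g z) - (\sum_(i < k) a i * z ^+ i - g z).
  by rewrite big_ord_recr /=; ring.
by apply: absD_lt; rewrite ?absN; apply: hm => //; apply: leqW.
Qed.

(** If no element of K reaches absolute value [r], the powers of every element are bounded, so the
    absolute value is trivial; convergence at 1 then makes almost all coefficients zero. *)
Lemma terms_radius (r : R) e : 0 <= r -> 0 < e ->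
  exists m, forall k, (m <= k)%N -> abs (a k) * r ^+ k < e.
Proof.
move=> r0 e0; have [[z rz]|nz] := pselect (exists z, r <= abs z).
  have [m hm] := terms_null z e0; exists m => k /hm; apply: le_lt_trans.
  by rewrite absM absX ler_wpM2l // lerXn2r ?nnegrE.
have bnd z : abs z < r by rewrite ltNge; apply/negP => h; apply: nz; exists z.
have le1 z : abs z <= 1.
  rewrite leNgt; apply/negP => /(exp_unbounded r)[n]; rewrite -absX => h.
  by have := lt_trans (bnd (z ^+ n)) h; rewrite ltxx.
have [m hm] := terms_null 1 ltr01; exists m => k /hm; rewrite expr1n mulr1 => ak1.
suff -> : a k = 0 by rewrite abs0 mul0r.
apply/eqP/negPn/negP => ak; have := le1 (a k)^-1.
rewrite leNgt; apply/negP/negPn; rewrite -(ltr_pM2l (x := abs (a k))) ?abs_gt0 //.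
by rewrite -absM divff // abs1 mulr1.
Qed.

Definition partial_sum (M : nat) : {poly K} := \poly_(k < M) a k.

Lemma coef_partial_sum M k : (partial_sum M)`_k = if (k < M)%N then a k else 0.
Proof. exact: coef_poly. Qed.

Lemma partial_sum_cvg z : abs_cvg abs (fun M => (partial_sum M).[z]) (g z).
Proof.
move=> e /(hg z)[m hm]; exists m => k /hm.
by rewrite /partial_sum horner_poly.
Qed.

Section Root.
Context {r : R} {J : nat}.
Hypotheses (r1 : 1 <= r) (J0 : (0 < J)%N) (aJ : a J != 0).
Hypothesis Jmax : forall k, abs (a k) * r ^+ k <= abs (a J) * r ^+ J.
Hypothesis Jlast : forall k, (J < k)%N -> abs (a k) * r ^+ k < abs (a J) * r ^+ J.

Let r0 : 0 < r. Proof. exact: lt_le_trans ltr01 r1. Qed.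

(* The Taylor coefficient of index J at w has the same absolute value as a J, because J is the last
   index at which abs (a k) * r ^+ k is maximal. *)
Lemma nearby_root M (w : K) (rho : R) : (J < M)%N -> abs w <= r -> 0 < rho -> rho <= r ->
  abs (partial_sum M).[w] <= abs (a J) * rho ^+ J ->
  exists w', [/\ (partial_sum M).[w'] = 0, abs w' <= r & abs (w' - w) <= rho].
Proof.
move=> JM wr rho0 rhor small; set p := partial_sum M.
have pJ : p`_J = a J by rewrite coef_partial_sum JM.
have Js : (J < size p)%N.
  by rewrite ltnNge; apply: contra aJ => h; rewrite -pJ nth_default.
(* The Taylor expansion at [w], with divided derivatives so that any characteristic is allowed. A
   root [h] of [q] gives the root [w + h] of [p]. *)
pose q := \poly_(i < size p) p^`N(i).[w].
have qJ : abs q`_J = abs (a J).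
  rewrite coef_poly Js (horner_coef_wide w (n := (size p).+1)); last first.
    apply: leq_trans (leqnSn _); apply/leq_sizeP => i pi.
    by rewrite coef_nderivn nth_default ?mul0rn // (leq_trans pi) // leq_addl.
  rewrite big_ord_recl /= coef_nderivn addn0 binn mulr1n pJ expr0 mulr1 abs_dominant //.
  apply: abs_sum_lt => [|i _]; first by rewrite abs_gt0.
  rewrite coef_nderivn absM absX.
  apply: (@le_lt_trans _ _ (abs (a (J + bump 0 i)) * r ^+ bump 0 i)).
    apply: ler_pM => //; rewrite ?exprn_ge0 ?lerXn2r ?nnegrE ?(ltW r0) //.
    apply: le_trans (abs_mulrn_le _ _) _; rewrite coef_partial_sum; case: ifP => // _.
    by rewrite abs0.
  rewrite -(ltr_pM2r (exprn_gt0 J r0)) -mulrA -exprD addnC [(_ + J)%N]addnC.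
  by apply: Jlast; rewrite /bump /= addnS ltnS leq_addr.
have q0 : q`_0 = p.[w] by rewrite coef_poly (leq_trans _ Js) // nderivn0.
have qJ0 : q`_J != 0 by rewrite -abs_gt0 qJ abs_gt0.
have [|h hq hr] := small_root rho0 J0 qJ0; first by rewrite q0 qJ.
exists (w + h); split.
- by rewrite nderiv_taylor; [rewrite -[RHS]hq horner_poly|apply: mulrC].
- by apply: absD_le => //; apply: le_trans rhor.
- by rewrite addrAC subrr add0r.
Qed.

Hypothesis hcomplete : abs_complete abs.

Lemma entire_root : exists z, g z = 0.
Proof.
pose rho (n : nat) : R := r / n.+1%:R.
have rho0 n : 0 < rho n by rewrite divr_gt0 // ltr0n.
have rhor n : rho n <= r by rewrite ler_pdivrMr ?ltr0n // ler_peMr ?(ltW r0) // ler1n.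
have rho_mono i j : (i <= j)%N -> rho j <= rho i.
  by move=> ij; rewrite ler_pM2l // lef_pV2 ?posrE ?ltr0n // ler_nat.
have rho_null e : 0 < e -> exists n, rho n < e.
  move=> e0; exists (Num.bound (r / e)); rewrite ltr_pdivrMr ?ltr0n //.
  rewrite mulrC -ltr_pdivrMr // (lt_trans (archi_boundP _)) ?divr_ge0 ?(ltW r0) ?(ltW e0) //.
  by rewrite ltr_nat.
have c0 n : 0 < abs (a J) * rho n ^+ J by rewrite mulr_gt0 ?exprn_gt0 // abs_gt0.
have /choice[m hm] n := terms_radius (ltW r0) (c0 n).
(* [J.+1] keeps the dominant term in every truncation, [n] makes the lengths unbounded, and summing
   all earlier [m i] makes them nondecreasing. *)
pose M n := (J.+1 + n + \sum_(i < n.+1) m i)%N.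
have JM n : (J < M n)%N by rewrite /M; lia.
have mM n : (m n <= M n)%N by rewrite /M big_ord_recr /=; lia.
have MS n : (M n <= M n.+1)%N by rewrite /M [in X in (_ <= X)%N]big_ord_recr /=; lia.
(* At a root of one truncation the next equals the sum of the added terms, which [m n] makes smaller
   than [abs (a J) * rho n ^+ J]; so [nearby_root] applies. *)
have /choice[next hnext] (nw : nat * K) : exists w', abs nw.2 <= r -> (partial_sum (M nw.1)).[nw.2] = 0 ->
    [/\ (partial_sum (M nw.1.+1)).[w'] = 0, abs w' <= r & abs (w' - nw.2) <= rho nw.1].
  case: nw => n w /=; have [[wr pw]|h] := pselect (abs w <= r /\ (partial_sum (M n)).[w] = 0); last first.
    by exists 0 => wr pw; case: h.
  have [|w' hw'] := nearby_root (JM n.+1) wr (rho0 n) (rhor n); last by exists w'.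
  rewrite -[X in abs X]subr0 -pw -hornerN -hornerD.
  rewrite (horner_coef_wide w (n := M n.+1)); last first.
    rewrite (leq_trans (size_polyD _ _)) // size_polyN geq_max size_poly /=.
    by apply: leq_trans (size_poly _ _) (MS n).
  apply: abs_sum_le => [|i _]; first exact: ltW.
  rewrite coefD coefN !coef_partial_sum ltn_ord; case: ltnP => ge.
    by rewrite subrr mul0r abs0 ltW.
  rewrite subr0 absM absX; apply: ltW; apply: le_lt_trans (hm n i (leq_trans (mM n) ge)).
  by rewrite ler_wpM2l // lerXn2r ?nnegrE // ltW.
have [||w0 [pw0 w0r _]] := nearby_root (w := 0) (JM 0%N) _ r0 (lexx r).
- by rewrite abs0 ltW.
- rewrite horner_coef0 coef_partial_sum (leq_ltn_trans _ (JM 0%N)) //.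
  by have := Jmax 0; rewrite expr0 mulr1.
pose w := fix w n := if n is n'.+1 then next (n', w n') else w0.
have hw n : abs (w n) <= r /\ (partial_sum (M n)).[w n] = 0.
  by elim: n => [|n [h1 h2]] //; have [] := hnext (n, w n) h1 h2.
have wstep n : abs (w n.+1 - w n) <= rho n.
  by have [h1 h2] := hw n; have [] := hnext (n, w n) h1 h2.
have wtail n k : abs (w (n + k)%N - w n) <= rho n.
  elim: k => [|k IH]; first by rewrite addn0 subrr abs0 ltW.
  rewrite addnS -(subrK (w (n + k)%N) (w (n + k).+1)) -addrA; apply: absD_le => //.
  by apply: le_trans (wstep _) _; apply: rho_mono; apply: leq_addr.
have [l hl] : exists l, abs_cvg abs w l.
  apply: hcomplete => e /rho_null[n hn]; exists n => j k nj nk.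
  have -> : w j - w k = (w j - w n) - (w k - w n) by ring.
  have wt i : (n <= i)%N -> abs (w i - w n) < e.
    by move=> ni; apply: le_lt_trans hn; rewrite -(subnKC ni); apply: wtail.
  by apply: absD_lt; rewrite ?absN; apply: wt.
have lw n : abs (l - w n) <= rho n.
  have [m' hm'] := hl _ (rho0 n).
  have -> : l - w n = (w (n + m')%N - w n) - (w (n + m')%N - l) by ring.
  by apply: absD_le => //; rewrite absN ltW // hm' // leq_addl.
have lr : abs l <= r.
  by rewrite -(subrK (w 0%N) l); apply: absD_le; [apply: le_trans (rhor 0%N)|case: (hw 0%N)].
exists l; apply: abs_small0 => e e0.
have TJ0 : 0 < abs (a J) * r ^+ J by rewrite mulr_gt0 ?exprn_gt0 // abs_gt0.
have [n hn] := rho_null _ (divr_gt0 e0 TJ0).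
have [m' hm'] := partial_sum_cvg l e0.
have Mn k : (k <= M k)%N by rewrite /M; lia.
set i := maxn n m'.
have -> : g l = ((partial_sum (M i)).[l] - (partial_sum (M i)).[w i]) - ((partial_sum (M i)).[l] - g l).
  by have [_ ->] := hw i; ring.
apply: absD_lt; last by rewrite absN; apply: hm'; rewrite (leq_trans _ (Mn i)) // leq_maxr.
(* Factoring z^k - w^k bounds it by |z - w| r^k on the disc, as r >= 1. All truncations thus share
   the Lipschitz constant [abs (a J) * r ^+ J]. *)
rewrite !horner_poly -sumrB; apply: abs_sum_lt => // k _.
rewrite -mulrBr subrXX mulrCA absM.
apply: (@le_lt_trans _ _ (rho n * (abs (a J) * r ^+ J))); last by rewrite -ltr_pdivlMr.
apply: ler_pM => //.
  by apply: le_trans (lw i) _; apply: rho_mono; apply: leq_maxl.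
apply: le_trans (Jmax k); rewrite absM ler_wpM2l //; apply: abs_sum_le => [|j _].
  by rewrite exprn_ge0 // ltW.
rewrite absM !absX; apply: (@le_trans _ _ (r ^+ (k.-1 - j) * r ^+ j)).
  by apply: ler_pM; rewrite ?exprn_ge0 // lerXn2r ?nnegrE ?(ltW r0) //; case: (hw i).
rewrite -exprD; apply: ler_weXn2l => //.
by have := ltn_ord j; lia.
Qed.

End Root.
End Coefs.
End NonArchimedean.

(** * Zero-free entire functions and the integral domain of entire functions *)

Section Entire.
Context {R : realType} {K : closedFieldType} {abs : K -> R}.
Hypotheses (habs : nonarch_absval abs) (hcomplete : abs_complete abs).

Let abs_ge0 x : 0 <= abs x. Proof. exact: absval_ge0 habs x. Qed.
Let absM x y : abs (x * y) = abs x * abs y. Proof. exact: absvalM habs x y. Qed.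

Lemma zero_free_coefs a g : entire_coefs (abs := abs) a g -> (forall z, g z != 0) ->
  forall j, (0 < j)%N -> a j = 0.
Proof.
move=> hg gn0 j j0; apply/eqP/negPn/negP => aj.
have aj0 : 0 < abs (a j) by rewrite (abs_gt0 habs).
(* Chosen so that |a_j| r > |a_0|; as r >= 1, term [j] beats term 0 at this radius, so the last
   dominant index [J] is positive. *)
pose r := 1 + abs (a 0%N) / abs (a j).
have r1 : 1 <= r by rewrite lerDl divr_ge0.
have r0 : 0 < r by apply: lt_le_trans ltr01 r1.
pose T k := abs (a k) * r ^+ k.
have T0j : T 0%N < T j.
  rewrite /T expr0 mulr1; apply: (@lt_le_trans _ _ (abs (a j) * r)).
    by rewrite mulrDr mulr1 mulrCA divff ?gt_eqF // mulr1 ltrDr.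
  by rewrite ler_pM2l // ler_eXnr.
have Tj0 : 0 < T j by rewrite mulr_gt0 ?exprn_gt0.
have [m hm] := terms_radius habs hg (ltW r0) Tj0.
have jm : (j < m)%N by rewrite ltnNge; apply/negP => /hm; rewrite ltxx.
case: (arg_maxP (fun i : 'I_m => T i) (i0 := Ordinal jm) (P := xpredT) isT) => k0 _ kmax.
have exk : exists k, (k < m)%N && (T k == T k0) by exists k0; rewrite ltn_ord eqxx.
have ubk k : (k < m)%N && (T k == T k0) -> (k <= m)%N by case/andP => /ltnW.
case: (ex_maxnP exk ubk) => J /andP[Jm /eqP TJ] Jlast.
have TjJ : T j <= T J by rewrite TJ; apply: (kmax (Ordinal jm)).
have J0 : (0 < J)%N.
  rewrite lt0n; apply/eqP => J0; move: (lt_le_trans T0j TjJ); by rewrite J0 ltxx.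
have aJ : a J != 0.
  by apply: contraTneq (lt_le_trans Tj0 TjJ) => e; rewrite /T e (abs0 habs) mul0r ltxx.
have Jmax k : T k <= T J.
  case: (ltnP k m) => km; first by rewrite TJ; apply: (kmax (Ordinal km)).
  by apply: le_trans TjJ; apply/ltW/hm.
have Jl k : (J < k)%N -> T k < T J.
  move=> Jk; rewrite lt_neqAle Jmax andbT; apply/negP => /eqP e.
  case: (ltnP k m) => km; first by have := Jlast k; rewrite km e TJ eqxx leqNgt Jk => /(_ isT).
  by have := hm k km; rewrite -/(T k) e ltNge TjJ.
have [z gz] := entire_root habs hg r1 J0 aJ Jmax Jl hcomplete.
by have := gn0 z; rewrite gz eqxx.
Qed.

Lemma const_coefs a g : entire_coefs (abs := abs) a g -> (forall j, (0 < j)%N -> a j = 0) ->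
  forall z, g z = a 0%N.
Proof.
move=> hg h z; apply: (abs_cvg_unique habs (hg z)) => e e0; exists 1%N => -[//|k] _.
rewrite big_ord_recl expr0 mulr1 big1 => [|i _]; first by rewrite addr0 subrr (abs0 habs).
by rewrite h ?mul0r.
Qed.

Theorem zero_free_const g : analytic_fun abs g -> (forall z, g z != 0) ->
  exists2 c, c != 0 & forall z, g z = c.
Proof.
move=> [a hg] gn0; have h := const_coefs hg (zero_free_coefs hg gn0).
by exists (a 0%N) => //; rewrite -(h 0).
Qed.

Lemma coefs_eq0 a g : entire_coefs (abs := abs) a g -> (forall z, g z = 0) -> forall k, a k = 0.
Proof.
move=> hg g0.
(* The function 1 + g has no zero. *)
have h1 : entire_coefs (abs := abs) (fun k => (k == 0)%:R + a k) (fun=> 1).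
  move=> z e /(hg z)[m hm]; exists m.+1 => -[//|k] mk.
  have -> : \sum_(i < k.+1) ((i == 0 :> nat)%:R + a i) * z ^+ i =
      1 + \sum_(i < k.+1) a i * z ^+ i.
    under eq_bigr => i _ do rewrite mulrDl.
    rewrite big_split /=; congr (_ + _); rewrite big_ord_recl big1 ?addr0 ?mul1r //.
    by move=> i _; rewrite mul0r.
  by have := hm k.+1 (ltnW mk); rewrite g0 subr0 addrC addrA addNr add0r.
have hpos j : (0 < j)%N -> a j = 0.
  move=> j0; have := zero_free_coefs h1 (fun=> oner_neq0 _) j0.
  by rewrite eqn0Ngt j0 add0r.
by case=> [|k]; [rewrite -(const_coefs hg hpos 0) g0|apply: hpos].
Qed.

Definition convolution (a b : nat -> K) k := \sum_(i < k.+1) a i * b (k - i)%N.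

Lemma coef_partial_sumM a b m k : (k < m)%N ->
  (partial_sum (a := a) m * partial_sum (a := b) m)`_k = convolution a b k.
Proof.
move=> km; rewrite coefM; apply: eq_bigr => i _.
have im : (i < m)%N by have := ltn_ord i; lia.
have kim : (k - i < m)%N by lia.
by rewrite !coef_partial_sum im kim.
Qed.

Lemma terms_bounded a g z : entire_coefs (abs := abs) a g ->
  exists2 B, 0 < B & forall k, abs (a k * z ^+ k) <= B.
Proof.
move=> hg; have [m hm] := terms_null habs hg z ltr01.
exists (1 + \sum_(i < m) abs (a i * z ^+ i)) => [|k].
  by rewrite ltr_pwDl ?ltr01 // sumr_ge0.
case: (ltnP k m) => km; last by rewrite (le_trans (ltW (hm k km))) // lerDl sumr_ge0.
rewrite (bigD1 (Ordinal km)) //= addrCA lerDl addr_ge0 ?ler01 // sumr_ge0 //.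
Qed.

Lemma entireM a b g h : entire_coefs (abs := abs) a g -> entire_coefs (abs := abs) b h ->
  entire_coefs (abs := abs) (convolution a b) (fun z => g z * h z).
Proof.
move=> hg hh z e e0.
have [A A0 hA] := terms_bounded z hg; have [B B0 hB] := terms_bounded z hh.
pose C := 1 + abs (g z) + abs (h z).
have C0 : 0 < C by rewrite /C -addrA ltr_pwDl ?ltr01 // addr_ge0.
have [m1 hm1] := terms_null habs hg z (divr_gt0 e0 B0).
have [m2 hm2] := terms_null habs hh z (divr_gt0 e0 A0).
have eC : 0 < Num.min 1 (e / C) by rewrite lt_min ltr01 divr_gt0.
have [m3 hm3] := partial_sum_cvg hg z eC.
have [m4 hm4] := partial_sum_cvg hh z eC.
exists (m1 + m2 + m3 + m4)%N => m hm.
set p := partial_sum (a := a) m; set q := partial_sum (a := b) m.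
have -> : \sum_(k < m) convolution a b k * z ^+ k - g z * h z =
   (\sum_(k < m) convolution a b k * z ^+ k - (p * q).[z]) +
   (p.[z] * (q.[z] - h z) + (p.[z] - g z) * h z) by rewrite hornerM; ring.
apply: (absD_lt habs).
  (* Below degree m, [p * q] has the coefficients of the convolution. In its higher terms either the
     first index is at least [m1] or, since m >= m1 + m2, the second is at least [m2]. *)
  rewrite (@horner_coef_wide _ (m + m) (p * q)); last first.
    apply: leq_trans (size_polyMleq _ _) _; apply: leq_trans (leq_pred _) _.
    by apply: leq_add; apply: size_poly.
  rewrite big_split_ord /= (_ : \sum_(i < m) (p * q)`_i * z ^+ i =
      \sum_(k < m) convolution a b k * z ^+ k); last first.
    by apply: eq_bigr => i _; rewrite coef_partial_sumM.
  rewrite opprD addrA subrr add0r (absN habs); apply: (abs_sum_lt habs) => // i _.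
  rewrite coefM mulr_suml; apply: (abs_sum_lt habs) => // j _.
  rewrite !coef_partial_sum.
  have -> : z ^+ (m + i) = z ^+ j * z ^+ (m + i - j) by rewrite -exprD subnKC // -ltnS.
  case: ifP => _; last by rewrite !mul0r (abs0 habs).
  case: ifP => _; last by rewrite mulr0 mul0r (abs0 habs).
  rewrite mulrACA absM; case: (leqP m1 j) => mj.
    apply: (@le_lt_trans _ _ (abs (a j * z ^+ j) * B)); first by rewrite ler_wpM2l.
    by rewrite -ltr_pdivlMr //; apply: hm1.
  apply: (@le_lt_trans _ _ (A * abs (b (m + i - j)%N * z ^+ (m + i - j)))).
    by rewrite ler_wpM2r.
  by rewrite mulrC -ltr_pdivlMr //; apply: hm2; lia.
have [pz1 pz2] : abs (p.[z] - g z) < 1 /\ abs (p.[z] - g z) < e / C.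
  by apply/andP; rewrite -lt_min; apply: hm3; lia.
have qz : abs (q.[z] - h z) < e / C.
  have : abs (q.[z] - h z) < Num.min 1 (e / C) by apply: hm4; lia.
  by rewrite lt_min => /andP[].
have lpC : abs p.[z] <= C.
  rewrite -(subrK (g z) p.[z]); apply: le_trans (absvalD_max habs _ _) _.
  rewrite ge_max; apply/andP; split; last by rewrite /C addrAC lerDr addr_ge0 ?ler01.
  by apply: le_trans (ltW pz1) _; rewrite /C -addrA lerDl addr_ge0.
apply: (absD_lt habs); rewrite absM.
  by apply: (@le_lt_trans _ _ (C * abs (q.[z] - h z))); [rewrite ler_wpM2r|rewrite mulrC -ltr_pdivlMr].
apply: (@le_lt_trans _ _ (abs (p.[z] - g z) * C)); last by rewrite -ltr_pdivlMr.
by rewrite ler_wpM2l // /C lerDr addr_ge0 ?ler01.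
Qed.

Lemma analytic_const c : analytic_fun abs (fun=> c).
Proof.
exists (fun k => if k == 0%N then c else 0) => z e e0; exists 1%N => -[//|k] _.
rewrite big_ord_recl expr0 mulr1 big1 => [|i _]; first by rewrite addr0 subrr (abs0 habs).
by rewrite mul0r.
Qed.

Lemma analyticD g h : analytic_fun abs g -> analytic_fun abs h ->
  analytic_fun abs (fun z => g z + h z).
Proof.
move=> [a hg] [b hh]; exists (fun k => a k + b k) => z e e0.
have [m hm] := hg z e e0; have [m' hm'] := hh z e e0; exists (maxn m m') => k.
rewrite geq_max => /andP[mk mk'].
have -> : \sum_(i < k) (a i + b i) * z ^+ i - (g z + h z) =
  (\sum_(i < k) a i * z ^+ i - g z) + (\sum_(i < k) b i * z ^+ i - h z).
  under eq_bigr => i _ do rewrite mulrDl.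
  by rewrite big_split opprD addrACA.
by apply: (absD_lt habs); [apply: hm|apply: hm'].
Qed.

Lemma analyticM g h : analytic_fun abs g -> analytic_fun abs h ->
  analytic_fun abs (fun z => g z * h z).
Proof. by move=> [a hg] [b hh]; exists (convolution a b); apply: entireM. Qed.

Lemma analytic_meval n (F : {mpoly K[n]}) (g : K -> 'I_n -> K) :
  (forall i, analytic_fun abs (g^~ i)) -> analytic_fun abs (fun z => F.@[g z]).
Proof.
move=> hg; have hX (G : {mpoly K[n]}) k : analytic_fun abs (fun z => G.@[g z]) ->
    analytic_fun abs (fun z => (G ^+ k).@[g z]).
  move=> hG; elim: k => [|k IH].
    by under eq_fun do rewrite expr0 meval1; apply: analytic_const.
  by under eq_fun do rewrite exprS mevalM; apply: analyticM.
elim/mpolyind: F => [|c m p _ _ IH].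
  by under eq_fun do rewrite meval0; apply: analytic_const.
under eq_fun do rewrite mevalD mevalZ; apply: analyticD => //.
apply: analyticM; first exact: analytic_const.
rewrite mpolyXE_id; elim/big_rec: _ => [|i x _ hx].
  by under eq_fun do rewrite meval1; apply: analytic_const.
under eq_fun do rewrite mevalM; apply: analyticM => //; apply: hX.
by under eq_fun do rewrite mevalXU.
Qed.

(** Uniqueness of coefficients reduces this to power series, where the product of the two lowest
    nonzero coefficients survives. *)
Lemma analytic_domain g h : analytic_fun abs g -> analytic_fun abs h ->
  (forall z, g z * h z = 0) -> (forall z, g z = 0) \/ (forall z, h z = 0).
Proof.
move=> [a hg] [b hh] gh0; have c0 := coefs_eq0 (entireM hg hh) gh0.
have zero u v : entire_coefs (abs := abs) u v -> (forall k, u k = 0) -> forall z, v z = 0.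
  by move=> huv u0 z; rewrite (const_coefs huv) ?u0.
case: (pselect (forall k, a k = 0)) => [|/existsNP[i0 /eqP ai0]]; first by move/(zero _ _ hg); left.
case: (pselect (forall k, b k = 0)) => [|/existsNP[j0 /eqP bj0]]; first by move/(zero _ _ hh); right.
case: (ex_minnP (ex_intro (fun i => a i != 0) i0 ai0)) => i ai imin.
case: (ex_minnP (ex_intro (fun j => b j != 0) j0 bj0)) => j bj jmin.
have := c0 (i + j)%N; rewrite /convolution.
have lt : (i < (i + j).+1)%N by rewrite ltnS leq_addr.
rewrite (bigD1 (Ordinal lt)) //= addKn big1 ?addr0 => [/eqP|k ki].
  by rewrite mulf_eq0 (negPf ai) (negPf bj).
have {}ki : (k : nat) != i by apply: contraNneq ki => e; apply/eqP/val_inj.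
case: (ltnP k i) => [lt1|ge].
  suff -> : a k = 0 by rewrite mul0r.
  by apply/eqP/negPn/negP => /imin; rewrite leqNgt lt1.
suff -> : b (i + j - k)%N = 0 by rewrite mulr0.
by apply/eqP/negPn/negP => /jmin; move: ki ge bj (ltn_ord k); lia.
Qed.

End Entire.

(** * Analytic maps omitting divisors *)

Section Assembly.
Context {K : closedFieldType} {N : nat}.
Local Notation PN := (proj_space K N).
Local Notation poly := {mpoly K[N.+1]}.

Lemma has_dim_unique (Y : set PN) d d' : has_dim Y d -> has_dim Y d' -> d = d'.
Proof.
by move=> [h1 h2] [h1' h2']; apply/eqP; rewrite eqn_leq h2' ?h2.
Qed.

(** Take a variety of largest dimension between W and Y; dimensions are bounded by n, and a strictly
    larger variety would have larger dimension. *)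
Lemma component_containing (X Y W : set PN) n : has_dim X n -> Y `<=` X ->
  variety W -> W `<=` Y -> exists2 Z, component Y Z & W `<=` Z.
Proof.
move=> [_ Xn] YX vW WY.
pose good d := `[< exists Z, [/\ variety Z, W `<=` Z, Z `<=` Y & dim_ge Z d] >].
have exd : exists d, good d.
  have [_ [p Wp] _] := vW; exists 0%N; apply/asboolP; exists W; split=> //; exact: dim_ge0 Wp.
have ubd d : good d -> (d <= n)%N.
  move=> /asboolP[Z [_ _ ZY dZ]]; apply: Xn; apply: dim_ge_sub dZ; exact: subset_trans YX.
case: (ex_maxnP exd ubd) => d /asboolP[Z [vZ WZ ZY dZ]] dmax.
exists Z => //; split=> // Z' vZ' ZZ' Z'Y; apply/seteqP; split=> //.
apply: contrapT => nZ'Z; have := dmax d.+1; rewrite ltnn => h; apply: notF; apply: h.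
apply/asboolP; exists Z'; split=> //; first exact: subset_trans ZZ'.
exact: dim_ge_extend nZ'Z dZ.
Qed.

Lemma homog0_polyC (F : poly) : F \is 0.-homog -> exists c, F = c%:MP.
Proof.
move=> hF; exists F@_0; apply: msize1_polyC.
have [->|nz] := eqVneq F 0; first by rewrite msize0.
by rewrite -mlead_deg // (dhomog_mf hF (mlead_supp nz)).
Qed.

Lemma homog_nonconst_pos (F : poly) : is_homog F -> (forall c, F <> c%:MP) -> pos_form F.
Proof.
move=> [[|d] hd] hc; last by exists d.+1.
by have [c /hc] := homog0_polyC hd.
Qed.

Lemma variety_of_dim_between (V Z : set PN) m k : variety V -> variety Z -> Z `<=` V ->
  ~ dim_ge Z m.+1 -> dim_ge V (m + k) -> ~ dim_ge V (m + k).+1 ->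
  exists W, [/\ variety W, Z `<=` W, W `<=` V, dim_ge W m & ~ dim_ge W m.+1].
Proof.
move=> vV vZ; elim: k V vV => [|k IH] V vV ZV nZ dV ndV.
  by rewrite addn0 in dV ndV; exists V; split.
rewrite !addnS in dV ndV.
have [|V' [vV' ZV' V'V nVV' dV']] := intermediate_variety vV vZ ZV _ dV ndV.
  move=> VZ; apply: nZ; apply: (dim_ge_le _ (dim_ge_sub VZ dV)).
  by rewrite ltnS leq_addr.
have [|W [vW ZW WV' dW ndW]] := IH V' vV' ZV' nZ dV'.
  by move=> h; apply: ndV; apply: dim_ge_extend nVV' h.
by exists W; split=> //; apply: subset_trans V'V.
Qed.

End Assembly.

(** * The Zariski closure of the image *)

Section Image.
Context {R : realType} {K : closedFieldType} {abs : K -> R}.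
Hypotheses (habs : nonarch_absval abs) (hcomplete : abs_complete abs).
Context {N : nat} {f : K -> proj_space K N} {g : K -> 'rV[K]_N.+1}.
Hypothesis g_analytic : forall i, analytic_fun abs (fun z => g z 0 i).
Hypothesis fg : forall z, val (f z) = <[g z]>%VS.
Local Notation PN := (proj_space K N).
Local Notation poly := {mpoly K[N.+1]}.

Lemma vanishes_image (F : poly) z : is_homog F ->
  vanishes_at F (f z) <-> F.@[g z 0] = 0.
Proof.
move=> [d hF]; split=> [h|h x]; first by apply: h; rewrite fg memv_line.
rewrite fg => /vlineP[t ->].
rewrite -[RHS](mulr0 (t ^+ d)) -h -(meval_scale _ _ hF).
by apply: meval_eq => i; rewrite mxE.
Qed.

Definition zariski_closure_image : set PN :=
  [set p | forall F, is_homog F -> (forall z, F.@[g z 0] = 0) -> vanishes_at F p].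

Lemma image_in_closure z : zariski_closure_image (f z).
Proof. by move=> F hF /(_ z); apply: (proj2 (vanishes_image _ hF)). Qed.

Lemma closure_sub (Y : set PN) : algebraic_set Y -> (forall z, Y (f z)) ->
  zariski_closure_image `<=` Y.
Proof.
move=> hY fY p hp; apply: (proj1 (algebraicP Y) hY) => F hF YF; apply: hp => // z.
by apply/vanishes_image => //; apply: YF.
Qed.

(** Forms pulled back along [g] are entire functions, so irreducibility is the absence of zero
    divisors among them. *)
Lemma closure_variety : variety zariski_closure_image.
Proof.
split; [|by exists (f 0); apply: image_in_closure|].
  apply/algebraicP => p hp F hF Fg; apply: hp => // q; exact.
move=> Y1 Y2 h1 h2 hU; apply: contrapT => /not_orP[n1 n2].
have [F [hF YF /existsNP[p /not_implyP[Zp Fp]]]] := separating_form h1 n1.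
have [G [hG YG /existsNP[q /not_implyP[Zq Gq]]]] := separating_form h2 n2.
have aF := analytic_meval habs F g_analytic; have aG := analytic_meval habs G g_analytic.
have [z|F0|G0] := analytic_domain habs hcomplete aF aG.
- apply/eqP; rewrite mulf_eq0; have [/YF|/YG] := hU _ (@image_in_closure z).
    by move=> /(proj1 (vanishes_image _ hF)) ->; rewrite eqxx.
  by move=> /(proj1 (vanishes_image _ hG)) ->; rewrite eqxx orbT.
- by apply: Fp; apply: Zp.
- by apply: Gq; apply: Zq.
Qed.

Lemma closure_common_zeros (F G : poly) : pos_form F -> pos_form G ->
  (forall z, ~ vanishes_at F (f z)) -> (forall z, ~ vanishes_at G (f z)) ->
  forall p, zariski_closure_image p -> vanishes_at F p -> vanishes_at G p.
Proof.
move=> pF pG nF nG p hp Fp.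
have const (H : poly) : pos_form H -> (forall z, ~ vanishes_at H (f z)) ->
    exists2 c, c != 0 & forall z, H.@[g z 0] = c.
  move=> pH nH; apply: (zero_free_const habs hcomplete (analytic_meval habs H g_analytic)) => z.
  apply/eqP => e; apply: (nH z); apply/vanishes_image => //; exact: pos_form_homog.
have [c c0 hc] := const F pF nF; have [c' c'0 hc'] := const G pG nG.
have [d d0 hd] := pF; have [d' d'0 hd'] := pG.
(* The exponents equalise the degrees and the scalars make both terms equal to c^d' c'^d along [g],
   so [H] vanishes on the closure. *)
pose H : poly := c' ^+ d *: F ^+ d' - c ^+ d' *: G ^+ d.
have hH : H \is (d * d').-homog.
  by rewrite rpredB // dhomogZ //; [|rewrite mulnC]; apply: dhomogMn.
have /(vanishes_coords p hH) : vanishes_at H p.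
  apply: hp => [|z]; first by exists (d * d')%N.
  by rewrite mevalB !mevalZ !rmorphXn /= hc hc' mulrC subrr.
move/(vanishes_coords p hd) in Fp.
rewrite mevalB !mevalZ !rmorphXn /= Fp expr0n eqn0Ngt d'0 mulr0 sub0r => /eqP.
rewrite oppr_eq0 mulf_eq0 !expf_eq0 (negPf c0) andbF /= => /andP[_ /eqP e].
exact/(vanishes_coords p hd').
Qed.

End Image.

Theorem theorem1 (R : realType) (K : closedFieldType) (abs : K -> R)
    (habs : nonarch_absval abs) (hcomplete : abs_complete abs)
    (N n q : nat) (hq : (2 <= q)%N)
    (X : set (proj_space K N))
    (hX : variety X) (hdim : has_dim X n) (hsm : nonsingular_of_dim X n)
    (P : 'I_q -> {mpoly K[N.+1]})
    (hPhomog : forall i, is_homog (P i))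
    (hPnonconst : forall i, forall c : K, P i <> c%:MP)
    (hPdiv : forall i, ~ (X `<=` zeros (P i)))
    (hgen : general_position X n (fun i => X `&` zeros (P i))) :
  (forall f : K -> proj_space K N,
     analytic_map_to abs (X `\` \bigcup_i (X `&` zeros (P i))) f ->
     (exists Z : set (proj_space K N),
        [/\ variety Z, Z `<=` X, has_codim X Z (minn n.+1 q).-1 &
            forall z, Z (f z)]) /\
     ((0 < n)%N -> algebraically_degenerate X f)) /\
  ((n.+1 <= q)%N ->
     K_hyperbolic abs (X `\` \bigcup_i (X `&` zeros (P i)))).
Proof.
have [Xn Xmax] := hdim; have i0 : 'I_q by apply: (Ordinal (ltnW hq)).
have pP i : pos_form (P i) by apply: homog_nonconst_pos.
set c := (minn n.+1 q).-1; have cn : (c <= n)%N by rewrite /c; lia.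
have main f : analytic_map_to abs (X `\` \bigcup_i (X `&` zeros (P i))) f ->
    exists Z, [/\ variety Z, Z `<=` X, has_dim Z (n - c) & forall z, Z (f z)].
  move=> [[g [ga _ fg]] fY].
  have nP i z : ~ vanishes_at (P i) (f z).
    by move=> h; have [Xf] := fY z; apply; exists i.
  have vW := closure_variety habs hcomplete ga fg.
  set W := zariski_closure_image (g := g) in vW.
  have WX : W `<=` X.
    by apply: (closure_sub fg (variety_algebraic hX)) => z; have [] := fY z.
  have WP i j p : W p -> vanishes_at (P i) p -> vanishes_at (P j) p.
    exact: (closure_common_zeros habs hcomplete ga fg).
  have WD p : W p -> vanishes_at (P i0) p -> forall j, (X `&` zeros (P j)) p.
    by move=> Wp hp j; split; [apply: WX|apply: WP Wp hp].
  (* Otherwise the section by [P i0] has dimension at least n - c. For q <= n this is n - q + 1, too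
     large for a component of the intersection; for q > n it is 0, which provides a point common to
     n + 1 divisors. *)
  have ndW : ~ dim_ge W (n - c).+1.
    move=> /(dim_hypersurface_section vW (pP i0)) dW.
    case: (leqP q n) => qn.
      have [W' [vW' W'W dW']] := dim_ge_variety dW.
      have W'D : W' `<=` \bigcap_j (X `&` zeros (P j)).
        by move=> p /W'W[Wp hp] j _; apply: WD.
      have DX : \bigcap_j (X `&` zeros (P j)) `<=` X by move=> p /(_ i0 Logic.I)[].
      have [Z hZ W'Z] := component_containing hdim DX vW' W'D.
      have [n' [d [hn' [_ Zd] e]]] := (proj1 hgen) qn Z hZ.
      have := Zd _ (dim_ge_sub W'Z dW'); have := has_dim_unique hdim hn'.
      by rewrite /c; lia.
    have [W' [[_ [p W'p] _] W'W _]] := dim_ge_variety dW; have [Wp hp] := W'W p W'p.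
    pose I : {set 'I_q} := [set widen_ord qn j | j : 'I_n.+1].
    have cI : #|I| = n.+1.
      by rewrite card_imset ?card_ord // => j l /(congr1 val) e; apply: val_inj.
    have : (\bigcap_(j in [set` I]) (X `&` zeros (P j))) p by move=> j _; apply: WD.
    by rewrite (proj2 hgen).
  have XE : n = (n - c + c)%N by rewrite subnK.
  have [||Z [vZ WZ ZX dZ ndZ]] := variety_of_dim_between (m := n - c) (k := c) hX vW WX ndW.
  - by rewrite -XE.
  - by move=> /Xmax; rewrite -XE ltnn.
  exists Z; split=> // [|z]; last exact/WZ/(image_in_closure fg).
  split=> // d hd; rewrite leqNgt; apply/negP => lt; apply: ndZ; exact: dim_ge_le hd.
split=> [f hf|nq f hf].
  have [Z [vZ ZX dZ fZ]] := main f hf; split.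
    by exists Z; split=> //; exists n, (n - c)%N; split=> //; rewrite subnK.
  move=> n0; exists Z; split=> //; first exact: variety_algebraic.
  (* From q >= 2 and n > 0 follows c >= 1, so [Z] has dimension below n. *)
  split=> // XZ; have [_ Zmax] := dZ; have := Zmax n (dim_ge_sub XZ Xn).
  by rewrite /c; lia.
have [Z [vZ ZX [_ Zmax] fZ]] := main f hf.
(* For q >= n + 1 one has c = n, so [Z] has dimension 0. *)
have [|p Zp] := dim0_point vZ; first by move/Zmax; rewrite /c; lia.
by exists p => z; have := fZ z; rewrite Zp.
Qed.
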